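(* Let $\mathrm{H}^n$ be the $n$-dimensional discrete Heisenberg group equipped with the restriction of the metric $d$ described in the context, and let $B_k=\{p\in\mathrm{H}^n : d(p,0)\le k\}$ for $k\in\mathbb{N}$. Then for every non-singular ergodic action of $\mathrm{H}^n$ on a standard probability space $(X,\mathcal{B},\mu)$ and every $f\in L^1(\mu)$, $$\lim_{k\to\infty}\frac{\sum_{g\in B_k}\hat g f}{\sum_{g\in B_k}\hat g 1}=\int f\,d\mu\qquad\mu\text{-almost everywhere.}$$
   Context: The continuous Heisenberg group $\mathbb{H}^n$ is the set $\mathbb{C}^n\times\mathbb{R}$ with product $(z,\tau)\cdot(w,\sigma)=(z+w,\ \tau+\sigma+\tfrac12\operatorname{Im}\langle z,w\rangle)$, where $\langle z,w\rangle=\sum_{j=1}^n\overline{z_j}w_j$; its identity is $0=(0,0)$. The discrete Heisenberg group $\mathrm{H}^n$ is the subgroup generated by the elements $(e_j,0)$ and $(ie_j,0)$, $j=1,\dots,n$; as a set $\mathrm{H}^n=\{(z,\tau): z\in\mathbb{Z}^n+i\mathbb{Z}^n,\ \tau\in\tfrac12\langle \operatorname{Re} z,\operatorname{Im} z\rangle_{\mathbb{R}^n}+\mathbb{Z}\}$. Dilations are $\delta_\lambda(z,\tau)=(\lambda z,\lambda^2\tau)$ for $\lambda>0$. The metric is $d(p,q)=\inf\{r>0:\delta_{1/r}(pq^{-1})\in B_{eucl}\}$, where $B_{eucl}$ is the closed Euclidean unit ball of $\mathbb{C}^n\times\mathbb{R}\cong\mathbb{R}^{2n+1}$; explicitly,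 for $p=(z,\tau)$, $q=(w,\sigma)$, $d(p,q)=\frac{1}{\sqrt2}\big(\|z-w\|^2+\sqrt{\|z-w\|^4+4(\tau-\sigma-\tfrac12\operatorname{Im}\langle z,w\rangle)^2}\big)^{1/2}$. A non-singular action of a countable group $G$ on $(X,\mathcal{B},\mu)$ is an action by measurable bijections $x\mapsto gx$ such that $\mu\circ g$ and $\mu$ have the same null sets; $\omega_g=\frac{d(\mu\circ g)}{d\mu}$ and for $f\in L^1$, $\hat g f(x)=f(gx)\omega_g(x)$. Ergodic means every $G$-invariant measurable set is null or conull. *)

(* Defs.v *)
From HB Require Import structures.
From mathcomp Require Import all_boot all_order all_algebra.
From mathcomp Require Import all_classical all_reals all_analysis.
Set Implicit Arguments. Unset Strict Implicit. Unset Printing Implicit Defensive.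
Import Order.TTheory GRing.Theory Num.Theory.
Local Open Scope classical_set_scope.
Local Open Scope ring_scope.

(* A point (z, tau) of C^n x R, with z = x + i y encoded by its real and
   imaginary parts x, y : R^n (C^n x R ~ R^(2n+1)). *)
Definition heis (R : realType) (n : nat) : Type :=
  (('I_n -> R) * ('I_n -> R) * R)%type.

Section Heis.
Variables (R : realType) (n : nat).
Implicit Types p q : heis R n.

Definition hx p : 'I_n -> R := p.1.1.
Definition hy p : 'I_n -> R := p.1.2.
Definition ht p : R := p.2.

(* Im <z, w> with <z,w> = sum_j conj(z_j) w_j *)
Definition imdot p q : R := \sum_(j < n) (hx p j * hy q j - hy p j * hx q j).

Definition hmul p q : heis R n :=
  ((fun j => hx p j + hx q j, fun j => hy p j + hy q j),
   ht p + ht q + 2^-1 * imdot p q).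

Definition hone : heis R n := ((fun _ => 0, fun _ => 0), 0).

Definition zdist2 p q : R :=
  \sum_(j < n) ((hx p j - hx q j) ^+ 2 + (hy p j - hy q j) ^+ 2).

Definition hdist p q : R :=
  (Num.sqrt 2)^-1 *
  Num.sqrt (zdist2 p q + Num.sqrt (zdist2 p q ^+ 2 +
     4 * (ht p - ht q - 2^-1 * imdot p q) ^+ 2)).

Definition inHd p : Prop :=
  (forall j, hx p j \is a Num.int) /\ (forall j, hy p j \is a Num.int) /\
  (ht p - 2^-1 * \sum_(j < n) hx p j * hy p j) \is a Num.int.

Definition Hball (k : nat) : set (heis R n) :=
  [set p | inHd p /\ hdist p hone <= k%:R].
End Heis.

(* Standard Borel space: Borel-isomorphic to a Borel subset of R
   (Kuratowski's characterization). *)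
Definition standard_borel (d : measure_display) (X : measurableType d)
    (R : realType) : Prop :=
  exists (phi : X -> R), measurable_fun setT phi /\ injective phi /\
    measurable (range phi) /\
    (forall B : set X, measurable B -> measurable (phi @` B)).

(* Main.v *)
(** Write [N p = d p 0], so that [d p q = N (p q^-1)] and [N^4 = N^2 |z|^2 + tau^2].
    For every [s >= 0] the group has a colouring with finitely many colours, their
    number independent of [s], such that if [p], [q] have the same colour and
    [Phi s <= N q <= N p], then [d p (v q) <= d p u] whenever [N u, N v <= s]: up to an
    error [s], a ball centred at [p] that reaches the origin contains [q].  For [s = 0]
    this gives the Besicovitch covering property, hence, by transference to the orbits
    along the balls (of polynomial growth), the weak (1,1) maximal inequality.  For
    [s > 0] it bounds the length of a chain of balls, each centred in the
    [s]-neighbourhood of the spheres of all larger ones; induction over the length of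
    such chains and over many scales shows that the [s]-neighbourhoods of the spheres
    carry asymptotically no mass, [sum_(fringe of B_k) omega = o (sum_(B_k) omega)]
    almost everywhere.  Therefore coboundaries [ghat h - h] with [h] bounded satisfy the
    theorem.  For [f >= 0] with integral [c], ergodicity allows one to move mass from [f]
    to the constant [c] along an enumeration of the group, writing [f - c] as a finite
    sum of such coboundaries plus [f_n - f'_n] with [f_n, f'_n >= 0] of the same small
    integral; the maximal inequality controls this remainder. *)

(* The measure need not be invariant, so the weights [omega] along an orbit are arbitrary: counting
   the points of a fringe says nothing about its mass, and the geometry of the balls has to replace
   a Følner property. The growth of the balls enters only through transference, which for each [K]
   needs a single [M] with [B (M + K)] at most twice as large as [B M]. The metric is
   right-invariant, so balls along an orbit are translates [B k * g]. Left multiplication by [g]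
   moves every point by exactly [N g], hence [g * B k] and [B k] differ only inside a fringe of
   [B k]; this ties coboundaries to fringes. The number of scales in the fringe estimate depends on
   the number of colours and the tolerances, not on the radii. The scales can therefore be chosen
   one after another, each so large that almost every point with infinitely many heavy fringes shows
   one between the previous scale and this one. *)
Require Import Defs.
From HB Require Import structures.
From mathcomp Require Import all_boot all_order all_algebra.
From mathcomp Require Import ring lra zify.
Set Implicit Arguments. Unset Strict Implicit. Unset Printing Implicit Defensive.
Import Order.TTheory GRing.Theory Num.Theory.
Local Open Scope ring_scope.

(** * Balls and fringes in a colourable metric *)

(* The number of scales used by [fringe_decay]: [J] rounds of [fringe_step], each of
   which spends one scale and the scales of a chain that is longer by one. *)
Fixpoint fringe_levels (R : archiRealFieldType) (C : nat) (eps : R) k (eta : R) : nat :=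
  if k is k'.+1 then
    let J := Num.bound (2 * C%:R / (eps * eta)) in
    (J * (fringe_levels C eps k' (eta / (2 * (J%:R * C%:R + 1)))).+1)%N
  else 0%N.

(** Here [y] is the origin of the overview, and [u] a point close to it that the ball centred at [p]
    reaches. With [s = 0], [u = y] and [v = q] the conclusion reads [d p q <= d p y]. Stating it for
    all base points [y] makes it meaningful without a group, so that it can be pulled back to finite
    index types. *)
Definition colorable_metric (R : numDomainType) (G : Type) (d : G -> G -> R)
    (C : nat) (Phi : R) : Prop :=
  [/\ forall x, d x x = 0, forall x y, d x y = d y x,
      forall x y z, d x z <= d x y + d y z, 0 <= Phi &
      forall s y, 0 <= s -> exists col : G -> 'I_C,
        forall p q u v, col p = col q -> Phi * s <= d q y -> d q y <= d p y ->
          d u y <= s -> d v q <= s -> d p v <= d p u].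

Lemma colorable_metric_comp (R : numDomainType) (G H : Type) (f : H -> G)
    (d : G -> G -> R) C Phi :
  colorable_metric d C Phi -> colorable_metric (fun x y => d (f x) (f y)) C Phi.
Proof.
move=> [dxx dsym dtri Phi0 dcol]; split=> // s y s0.
by have [col colP] := dcol s (f y) s0; exists (col \o f) => p q u v; apply: colP.
Qed.

Section Combinatorics.
Variables (R : archiRealFieldType) (T : finType) (d : T -> T -> R).
Variables (C : nat) (Phi : R).
Hypothesis dC : colorable_metric d C Phi.

Let dxx x : d x x = 0. Proof. by have [] := dC. Qed.
Let dsym x y : d x y = d y x. Proof. by have [] := dC. Qed.
Let dtri x y z : d x z <= d x y + d y z. Proof. by have [] := dC. Qed.
Let Phi0 : 0 <= Phi. Proof. by have [] := dC. Qed.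
Let dcol s y : 0 <= s -> exists col : T -> 'I_C,
  forall p q u v, col p = col q -> Phi * s <= d q y -> d q y <= d p y ->
    d u y <= s -> d v q <= s -> d p v <= d p u.
Proof. by have [? ? ? ?] := dC; apply. Qed.

Implicit Types (x y z : T) (r s : R) (F S D U : {set T}).

Definition cball x r : {set T} := [set y | d x y <= r].

(** The [s]-neighbourhood of a sphere. No point need lie at distance exactly [r], so the sphere
    itself is replaced by closeness to both the ball and its complement. *)
Definition fringe s x r : {set T} :=
  [set y | [exists u, (d u y <= s) && (d x u <= r)] &&
           [exists v, (d v y <= s) && (r < d x v)]].

Definition thicken s F : {set T} := [set y | [exists x in F, d x y <= s]].

Lemma fringeP s x r y :
  reflect ((exists2 u, d u y <= s & d x u <= r) /\
           (exists2 v, d v y <= s & r < d x v)) (y \in fringe s x r).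
Proof.
rewrite inE; apply: (iffP andP) => -[].
  by move=> /existsP[u /andP[? ?]] /existsP[v /andP[? ?]]; split; [exists u|exists v].
move=> [u ? ?] [v ? ?]; split; apply/existsP; [exists u|exists v]; exact/andP.
Qed.

Lemma fringe_dist s x r y : y \in fringe s x r -> r - s <= d x y <= r + s.
Proof.
move=> /fringeP[[u uy xu] [v vy xv]]; apply/andP; split.
  by have := dtri x y v; rewrite (dsym y v); lra.
by have := dtri x u y; lra.
Qed.

Lemma fringe_near s s' x r y z :
  y \in fringe s x r -> d y z <= s' -> z \in fringe (s + s') x r.
Proof.
move=> /fringeP[[u uy xu] [v vy xv]] yz; apply/fringeP; split.
  by exists u => //; have := dtri u y z; lra.
by exists v => //; have := dtri v y z; lra.
Qed.

Lemma fringe_sub s s' x r : s <= s' -> fringe s x r \subset fringe s' x r.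
Proof.
move=> ss'; apply/subsetP => y yF; rewrite -[s'](subrKC s).
by apply: (fringe_near yF); rewrite dxx subr_ge0.
Qed.

Lemma thickenP s F y : reflect (exists2 x, x \in F & d x y <= s) (y \in thicken s F).
Proof.
rewrite inE; apply: (iffP existsP) => [[x /andP[]]|[x ? ?]]; exists x => //.
exact/andP.
Qed.

Lemma thickenS s s' F F' : s <= s' -> F \subset F' -> thicken s F \subset thicken s' F'.
Proof.
move=> ss /subsetP FF; apply/subsetP => y /thickenP[x xF xy].
by apply/thickenP; exists x; [exact: FF|lra].
Qed.

Lemma besicovitch_select F (r : T -> R) : (forall x, x \in F -> 0 <= r x) ->
  exists S, [/\ S \subset F,
    forall y, y \in F -> exists2 x, x \in S & d x y <= r x &
    forall x y, x \in S -> y \in S -> x != y -> Num.max (r x) (r y) < d x y].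
Proof.
elim: {F}_.+1 {-2}F (ltnSn #|F|) => // n IH F Fn rF.
have [->|[x0 x0F]] := set_0Vmem F.
  by exists set0; split=> // [y|x y]; rewrite in_set0.
(* Greedy choice of a largest radius: all later centres lie outside this ball, which separates them
   by the larger of the two radii. *)
pose x := [arg max_(i > x0 in F) r i]%O.
have [xF xmax] : x \in F /\ (forall y, y \in F -> r y <= r x).
  by rewrite /x; case: Order.TotalTheory.arg_maxP => // i ? ?; split.
have [||S [SF Scov Ssep]] := IH (F :\: cball x (r x)).
- rewrite ltnS in Fn; apply: leq_trans Fn; apply/proper_card/properP; split.
    exact: subsetDl.
  by exists x => //; rewrite !inE dxx rF.
- by move=> y /setDP[/rF].
have Sx y : y \in S -> y \in F /\ r x < d x y.
  by move/(subsetP SF); rewrite !inE ltNge => /andP[].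
exists (x |: S); split.
- by apply/subsetP => y; rewrite !inE => /orP[/eqP->//|/Sx[]].
- move=> y yF; have [yx|yx] := boolP (d x y <= r x).
    by exists x; rewrite ?setU11.
  have [|z zS zy] := Scov y; first by rewrite !inE yx.
  by exists z => //; rewrite inE zS orbT.
- move=> y z; rewrite !inE => /orP[/eqP->|yS] /orP[/eqP->|zS].
  + by rewrite eqxx.
  + by move=> _; have [zF] := Sx z zS; rewrite max_l ?xmax.
  + by move=> _; have [yF] := Sx y yS; rewrite dsym max_r ?xmax.
  + exact: Ssep.
Qed.

(** If two selected centres had the same colour, the ball of the one farther from [y] would reach
    the [s]-neighbourhood of [y] and hence contain the nearer centre, against the separation. *)
Lemma separated_multiplicity S (r : T -> R) s y : 0 <= s ->
  (forall x z, x \in S -> z \in S -> x != z -> Num.max (r x) (r z) < d x z) ->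
  (#|[set x in S | (Phi * s <= d x y)%R &&
        [exists u, (d u y <= s)%R && (d x u <= r x)%R]]| <= C)%N.
Proof.
move=> s0 sep; set A := [set _ in _ | _].
have [col colP] := dcol y s0.
rewrite -[leqRHS](card_ord C) -(card_in_imset (f := col) (D := A)) ?max_card //.
suff aux p q : p \in A -> q \in A -> col p = col q -> d q y <= d p y -> p = q.
  move=> p q pA qA cpq; have [|/ltW] := leP (d q y) (d p y).
    exact: aux.
  by move=> /aux-> //.
rewrite !inE => /and3P[pS _ /existsP[u /andP[uy pu]]] /and3P[qS qs _] cpq qp.
apply/eqP/negPn/negP => npq; have := sep _ _ pS qS npq.
have := colP _ _ _ q cpq qs qp uy; rewrite dxx => /(_ s0) pq.
by rewrite gt_max ltNge (le_trans pq pu).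
Qed.

Variable w : T -> R.
Hypothesis w0 : forall x, 0 <= w x.

Definition mass F := \sum_(x in F) w x.

Lemma mass_ge0 F : 0 <= mass F.
Proof. by apply: sumr_ge0. Qed.

Lemma massS F F' : F \subset F' -> mass F <= mass F'.
Proof.
move=> FF'; rewrite /mass [leRHS](big_setID F) /= (setIidPr FF') lerDl.
by apply: sumr_ge0.
Qed.

Lemma massU F F' : [disjoint F & F'] -> mass (F :|: F') = mass F + mass F'.
Proof. 
move=> FF'; rewrite /mass -bigU //; apply: eq_bigl => x.
by rewrite !inE.
Qed.

Lemma mass_multiplicity (I : finType) (S : {set I}) (A : I -> {set T}) U :
  (forall i, i \in S -> A i \subset U) ->
  (forall y, y \in U -> (#|[set i in S | y \in A i]| <= C)%N) ->
  \sum_(i in S) mass (A i) <= C%:R * mass U.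
Proof.
move=> AU mult; rewrite /mass.
rewrite (eq_bigr (fun i => \sum_(y in U) (y \in A i)%:R * w y)); last first.
  move=> i iS; rewrite big_mkcond [RHS]big_mkcond /=; apply: eq_bigr => y _.
  case: ifPn => [/(subsetP (AU _ iS))->|_]; first by rewrite mul1r.
  by rewrite mul0r if_same.
rewrite exchange_big mulr_sumr /=; apply: ler_sum => y yU.
rewrite -mulr_suml ler_wpM2r // -natr_sum ler_nat.
apply: leq_trans (mult y yU); rewrite -sum1_card [leqRHS](eq_bigl _ _ (in_set _)).
by rewrite big_mkcondr.
Qed.

Lemma mass_cover (I : finType) (S : {set I}) (A : I -> {set T}) F :
  (forall y, y \in F -> exists2 i, i \in S & y \in A i) ->
  mass F <= \sum_(i in S) mass (A i).
Proof.
move=> cov; rewrite /mass.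
under [leRHS]eq_bigr do rewrite big_mkcond.
rewrite exchange_big /= big_mkcond; apply: ler_sum => y _.
case: ifPn => [/cov[i iS yi]|_]; last by apply: sumr_ge0 => i _; case: ifP.
by rewrite (bigD1 i) //= yi lerDl; apply: sumr_ge0 => j _; case: ifP.
Qed.


Variables (Rad : nat -> R) (rho : nat -> T -> R) (t eps : R).
Hypothesis t0 : 0 <= t.
Hypothesis eps0 : 0 < eps.
Hypothesis tRad : t <= Rad 0.
Hypothesis RadS : forall i, Rad i <= Rad i.+1.
(** Fringes of width up to [5 * Rad i] occur around balls of radius at least [Psi * Rad i]; their
    points then stay at distance at least [Phi * (5 * Rad i)] from the centre, as the colouring
    demands. *)
Let Psi := 5 * (Phi + 1).

Let Psi0 : 0 <= Psi.
Proof. by rewrite mulr_ge0 // addr_ge0. Qed.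

Definition heavy_fringe i F := forall g, g \in F ->
  [/\ Psi * Rad i <= rho i g, rho i g <= Rad i.+1 &
      eps * mass (cball g (rho i g)) <= mass (fringe t g (rho i g))].

(** The list runs from the largest ball to the smallest. The factor 3, with the lower bound on the
    radii, makes the smaller ball the one whose centre is nearer to any point of [F]. *)
Definition fringe_chain s q (beta : seq (T * R)) F :=
  (forall b, b \in beta -> F \subset fringe s b.1 b.2 /\ Psi * q <= b.2) /\
  pairwise (fun b c => (c.1 \in fringe s b.1 b.2) && (3 * c.2 <= b.2)) beta.

Lemma Rad_le i j : (i <= j)%N -> Rad i <= Rad j.
Proof. by move=> ij; apply: (homo_leq (r := <=%R)) ij => // x y z; apply: le_trans. Qed.

Lemma tRad_le i : t <= Rad i.
Proof. exact: le_trans tRad (Rad_le (leq0n i)). Qed.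

Lemma Rad_ge0 i : 0 <= Rad i.
Proof. exact: le_trans t0 (tRad_le i). Qed.

Lemma PsiRad i : 3 * Rad i <= Psi * Rad i /\ 5 * Rad i + Phi * (5 * Rad i) <= Psi * Rad i.
Proof. by have := mulr_ge0 Phi0 (Rad_ge0 i); rewrite /Psi => ?; split; have := Rad_ge0 i; lra. Qed.

(* The centres of a chain have pairwise distinct colours: for two of the same colour,
   the larger ball would contain the point outside it close to the smaller centre. *)
Lemma fringe_chain_size a q beta F g : g \in F -> Rad a <= q ->
  fringe_chain (3 * Rad a) q beta F -> (size beta <= C)%N.
Proof.
move=> gF aq [bF bpw]; set s := 3 * Rad a in bF bpw.
have s0 : 0 <= s by have := Rad_ge0 a; rewrite /s; lra.
have [col colP] := dcol g s0.
rewrite -[leqRHS](card_ord C) -(size_map (fun b => col b.1)) cardE.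
apply: uniq_leq_size => [|i _]; last by rewrite mem_enum.
rewrite uniq_pairwise pairwise_map.
apply: (sub_in_pairwise (P := mem beta)) (allss beta) bpw => -[p r] [x r'] /=.
move=> /bF[/subsetP/(_ g gF)/= gp pr] /bF[/subsetP/(_ g gF)/= gx xr].
move=> /andP[/fringeP[_ [v vx pv]] r'r]; apply/eqP => pxcol.
have [h1 h3] := PsiRad a; have h2 := ler_wpM2l Psi0 aq; have h4 := mulr_ge0 Phi0 (Rad_ge0 a).
have /andP[g1 g2] := fringe_dist gp; have /andP[g3 g4] := fringe_dist gx.
rewrite /= in pr xr; have ra := Rad_ge0 a.
have [[u ug pu] _] := fringeP _ _ _ _ gp.
have := colP p x u v pxcol _ _ ug vx; rewrite leNgt => /(_ _ _)/negP; apply.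
- rewrite /s in g1 g2 g3 g4 *; lra.
- rewrite /s in g1 g2 g3 g4 *; lra.
- lra.
Qed.

Lemma fringe_chain_sub s s' q q' beta F F' : s <= s' -> q' <= q -> F' \subset F ->
  fringe_chain s q beta F -> fringe_chain s' q' beta F'.
Proof.
move=> ss qq FF [bF bpw]; split=> [b /bF[bs br]|].
  split; first exact: subset_trans FF (subset_trans bs (fringe_sub _ _ ss)).
  exact: le_trans (ler_wpM2l Psi0 qq) br.
apply: sub_pairwise bpw => b c /andP[bc ->]; rewrite andbT.
exact: (subsetP (fringe_sub _ _ ss)).
Qed.

Lemma fringe_multiplicity i s S y : 0 <= s -> s <= 5 * Rad i ->
  (forall x, x \in S -> Psi * Rad i <= rho i x) ->
  (forall x z, x \in S -> z \in S -> x != z -> Num.max (rho i x) (rho i z) < d x z) ->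
  (#|[set x in S | y \in fringe s x (rho i x)]| <= C)%N.
Proof.
move=> s0 sR Srho Ssep; apply: leq_trans (separated_multiplicity y s0 Ssep).
apply/subset_leq_card/subsetP => x; rewrite in_set => /andP[xS yx].
rewrite in_set xS /=; apply/andP; split.
  have /andP[xy _] := fringe_dist yx.
  have [_ h] := PsiRad i; have := Srho _ xS; have := ler_wpM2l Phi0 sR; lra.
by have /fringeP[[u uy xu] _] := yx; apply/existsP; exists u; rewrite uy.
Qed.

(* Each round selects balls of radii [rho b] at its top scale [b] and puts their fringes
   into [D].  The points of [F] far from these fringes go on to the next, smaller scales,
   and contribute disjoint fringes; on the others the selected ball prolongs the chain,
   so that the hypothesis on longer chains makes them negligible. *)
Lemma fringe_step m eta k : 0 <= eta ->
  (forall a F beta, (forall i, (a <= i < a + m)%N -> heavy_fringe i F) ->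
     fringe_chain (3 * Rad a) (Rad (a + m)) beta F -> (C < k + size beta)%N ->
     mass F <= eta * mass (thicken (2 * Rad (a + m)) F)) ->
  forall a J F beta V, (forall i, (a <= i < a + J * m.+1)%N -> heavy_fringe i F) ->
    fringe_chain (3 * Rad a) (Rad (a + J * m.+1)) beta F ->
    (C < k.+1 + size beta)%N ->
    mass (thicken (2 * Rad (a + J * m.+1)) F) <= V ->
  exists D : {set T}, (forall z, z \in D -> exists2 y, y \in F &
      exists2 r, r <= Rad (a + J * m.+1) & z \in fringe t y r) /\
    eps * J%:R * (mass F - J%:R * (eta * (C%:R * V))) <= C%:R * mass D.
Proof.
move=> eta0 IHk a; elim=> [|J IHJ] F beta V Fhf Fch Csz FV.
  exists set0; split=> [z|]; first by rewrite in_set0.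
  by rewrite mulr0 mul0r /mass big_set0 mulr0.
(* The scale [b] is spent on the selection, the [m] scales from [c] up to [b] on the prolonged
   chains, and those below [c] on the other [J] rounds. *)
set c := (a + J * m.+1)%N in IHJ *; pose b := (c + m)%N.
have bE : (a + J.+1 * m.+1 = b.+1)%N by rewrite /b /c mulSn; clear; lia.
rewrite bE in Fhf Fch FV *.
have ac : (a <= c)%N by rewrite leq_addr.
have cb : (c <= b)%N by rewrite leq_addr.
have bc : (c + m = b)%N by [].
clearbody b c; clear bE.
have cb1 : (c <= b.+1)%N by exact: leqW.
have sub1 i : (a <= i < c)%N -> (a <= i < b.+1)%N.
  by case/andP=> -> ic /=; exact: leq_trans ic cb1.
have sub2 i : (c <= i < b)%N -> (a <= i < b.+1)%N.
  by case/andP=> ci ib; rewrite (leq_trans ac ci) ltnW.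
have bab : (a <= b < b.+1)%N by rewrite leqnn (leq_trans ac cb).
have Fb g : g \in F -> Psi * Rad b <= rho b g /\ rho b g <= Rad b.+1.
  by move=> gF; have [] := Fhf b bab g gF.
have [g gF|S [SF Scov Ssep]] := @besicovitch_select F (rho b).
  by have [+ _] := Fb g gF; apply: le_trans; rewrite mulr_ge0 ?Rad_ge0.
have Sb x : x \in S -> Psi * Rad b <= rho b x by move/(subsetP SF)/Fb => -[].
pose D0 := \bigcup_(x in S) fringe t x (rho b x).
pose F2 x := F :&: fringe (3 * Rad c) x (rho b x).
pose F1 := F :\: \bigcup_(x in S) fringe (3 * Rad c) x (rho b x).
have F1F : F1 \subset F by exact: subsetDl.
have V0 : 0 <= V by exact: le_trans (mass_ge0 _) FV.
have [|||D1 [D1F D1m]] := IHJ F1 beta V _ _ Csz.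
- by move=> i /sub1 ci g /(subsetP F1F) gF; exact: Fhf ci g gF.
- by apply: fringe_chain_sub Fch => //; apply: Rad_le.
- apply: le_trans FV; apply/massS/thickenS => //.
  by rewrite ler_pM2l // Rad_le.
exists (D0 :|: D1); split.
  move=> z /setUP[/bigcupP[x xS zx]|/D1F[y yF1 [r rc zy]]].
    exists x; first exact: (subsetP SF).
    by exists (rho b x) => //; have [] := Fb x (subsetP SF _ xS).
  exists y; first exact: (subsetP F1F).
  by exists r => //; apply: le_trans rc (Rad_le _).
(* A common point would lie within [Rad c + t] of some [y] in [F1], and put [y] into a fringe of
   width [t + Rad c + t <= 3 * Rad c] of a selected ball, which [F1] avoids. This fixes the constant
   3. *)
have D01 : [disjoint D0 & D1].
  rewrite -setI_eq0; apply/eqP/setP => z; rewrite in_set0; apply/negP.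
  move=> /setIP[/bigcupP[x xS zx] /D1F[y /setDP[yF /negP yn] [r rc zy]]]; apply: yn.
  apply/bigcupP; exists x => //; apply: (subsetP (fringe_sub (s := t + (Rad c + t)) _ _ _)).
    by have := tRad_le c; lra.
  by apply: (fringe_near zx); rewrite dsym; have /andP[] := fringe_dist zy; lra.
have D0m : eps * mass F <= C%:R * mass D0.
  have Fcov : mass F <= \sum_(x in S) mass (cball x (rho b x)).
    by apply: mass_cover => y /Scov[x xS xy]; exists x => //; rewrite inE.
  apply: le_trans (ler_wpM2l (ltW eps0) Fcov) _; rewrite mulr_sumr.
  apply: (@le_trans _ _ (\sum_(x in S) mass (fringe t x (rho b x)))).
    by apply: ler_sum => x /(subsetP SF) xF; have [] := Fhf b bab x xF.
  apply: mass_multiplicity => [x xS|y _]; first exact: bigcup_sup.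
  by apply: fringe_multiplicity => //; have := tRad_le b; have := Rad_ge0 b; lra.
have F12 : mass F <= mass F1 + eta * (C%:R * V).
  rewrite -{1}(setID F (\bigcup_(x in S) fringe (3 * Rad c) x (rho b x))) massU; last first.
    rewrite -setI_eq0; move: (\bigcup_(x in S) _) => B; apply/eqP/setP => y.
    by rewrite !inE; case: (y \in B); rewrite ?andbF.
  rewrite addrC lerD2l.
  apply: (@le_trans _ _ (\sum_(x in S) mass (F2 x))).
    apply: mass_cover => y /setIP[yF /bigcupP[x xS yx]].
    by exists x => //; apply/setIP.
  apply: (@le_trans _ _ (\sum_(x in S) eta * mass (thicken (2 * Rad b) (F2 x)))).
    apply: ler_sum => x xS; have xF := subsetP SF _ xS.
    have [xb1 xb2] := Fb x xF; have [bF bpw] := Fch.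
    have Fx : F2 x \subset F by exact: subsetIl.
    rewrite -bc; apply: (IHk c (F2 x) (rcons beta (x, rho b x))); rewrite ?bc.
    + by move=> i /sub2 ci g /(subsetP Fx) gF; exact: Fhf ci g gF.
    + have [Fch1 Fch2] : fringe_chain (3 * Rad c) (Rad b) beta (F2 x).
        apply: fringe_chain_sub Fch => //.
        by rewrite ler_pM2l // Rad_le.
      split=> [q|]; last first.
        rewrite pairwise_rcons Fch2 andbT; apply/allP => q qb /=.
        have [/subsetP/(_ x xF) qx qr] := bF q qb; apply/andP; split.
          by apply: (subsetP (fringe_sub _ _ _)) qx; rewrite ler_pM2l // Rad_le.
        by have [+ _] := PsiRad b.+1; lra.
      rewrite mem_rcons inE => /orP[/eqP->/=|/Fch1//]; split=> //.
      exact: subsetIr.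
    + by rewrite size_rcons addnS.
  rewrite -mulr_sumr ler_wpM2l //.
  apply: le_trans (ler_wpM2l _ FV) => //.
  (* Thickening by [2 * Rad b] widens the fringes from [3 * Rad c] to at most [5 * Rad b], the width
     up to which [Psi] controls their overlaps. *)
  apply: (@le_trans _ _ (\sum_(x in S) mass (thicken (2 * Rad b) F :&:
           fringe (5 * Rad b) x (rho b x)))).
    apply: ler_sum => x xS; apply/massS/subsetP => y yF2; rewrite inE; apply/andP; split.
      by apply: (subsetP (thickenS _ _)) yF2 => //; exact: subsetIl.
    have /thickenP[z /setIP[zF zx] zy] := yF2.
    apply: (subsetP (fringe_sub _ _ _)) (fringe_near zx zy).
    by have := Rad_le cb; lra.
  apply: (@le_trans _ _ (C%:R * mass (thicken (2 * Rad b) F))); last first.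
    by rewrite ler_wpM2l //; apply/massS/thickenS => //; rewrite ler_pM2l // Rad_le.
  apply: mass_multiplicity => [x xS|y _]; first exact: subsetIl.
  apply: leq_trans (fringe_multiplicity (i := b) (s := 5 * Rad b) y _ _ Sb Ssep) => //.
    apply/subset_leq_card/subsetP => x; rewrite in_set => /andP[xS /setIP[_ xy]].
    by rewrite in_set xS.
  by have := Rad_ge0 b; lra.
rewrite massU // mulrDr.
have X0 : 0 <= eta * (C%:R * V) by rewrite !mulr_ge0.
move: (eta * (C%:R * V)) X0 F12 D1m => X X0 F12 D1m.
have J0 : 0 <= eps * J%:R by rewrite mulr_ge0 // ltW.
have h := ler_wpM2l J0 F12; have h' := mulr_ge0 (ltW eps0) X0.
have h'' := mulr_ge0 J0 X0.
rewrite -[J.+1]addn1 natrD; clear -D0m D1m h h' h''; lra.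
Qed.

Lemma fringe_decay k eta : 0 < eta ->
  forall a F beta (M := fringe_levels C eps k eta),
    (forall i, (a <= i < a + M)%N -> heavy_fringe i F) ->
    fringe_chain (3 * Rad a) (Rad (a + M)) beta F -> (C < k + size beta)%N ->
  mass F <= eta * mass (thicken (2 * Rad (a + M)) F).
Proof.
elim: k eta => [|k IHk] eta eta0 a F beta /=.
  move=> _ Fch Csz; have [->|[g gF]] := set_0Vmem F.
    by rewrite {1}/mass big_set0 mulr_ge0 ?mass_ge0 // ltW.
  have := fringe_chain_size gF _ Fch; rewrite addn0 lexx leqNgt => /(_ isT)/negP.
  by rewrite add0n in Csz.
(* Each round yields new disjoint fringes of mass about [eps / C] times that of [F]. [J] is so large
   that [mass F > eta * mass U] would make them outweigh [U], even after replacing [eta] by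
   [eta / 2]; [eta'] keeps the accumulated losses below that other half. *)
set J := Num.bound _; set eta' := eta / _; set m := fringe_levels _ _ _ _.
have Jh : 2 * C%:R < J%:R * (eps * eta).
  have ee0 : 0 < eps * eta by rewrite mulr_gt0.
  rewrite -ltr_pdivrMr //; apply: archi_boundP.
  by apply: divr_ge0; [rewrite mulr_ge0|exact: ltW].
have den0 : 0 < 2 * (J%:R * C%:R + 1) :> R.
  by rewrite mulr_gt0 // ltr_wpDl // mulr_ge0.
have eta'0 : 0 < eta' by rewrite divr_gt0.
move=> Fhf Fch Csz; set U := thicken _ F.
have [D [DF Dm]] := fringe_step (ltW eta'0) (IHk eta' eta'0) Fhf Fch Csz (lexx _).
have FU : F \subset U.
  by apply/subsetP => x xF; apply/thickenP; exists x => //; rewrite dxx mulr_ge0 ?Rad_ge0.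
have DU : D \subset U.
  apply/subsetP => z /DF[y yF [r rR zy]]; apply/thickenP; exists y => //.
  by have /andP[_] := fringe_dist zy; have := tRad_le (a + J * m.+1); lra.
have mD : C%:R * mass D <= C%:R * mass U by rewrite ler_wpM2l // massS.
have mF := massS FU; rewrite -/U in Dm.
have eJ : J%:R * (eta' * (C%:R * mass U)) <= eta / 2 * mass U.
  rewrite [leLHS](_ : _ = eta' * (J%:R * C%:R) * mass U); last by ring.
  apply: ler_wpM2r; first exact: mass_ge0.
  have JC0 : 0 < J%:R * C%:R + 1 :> R by rewrite ltr_wpDl // mulr_ge0.
  rewrite (_ : _ * _ = eta / 2 * (J%:R * C%:R / (J%:R * C%:R + 1))); last first.
    by rewrite /eta'; field; rewrite gt_eqF.
  apply: ler_piMr; first by rewrite divr_ge0 // ltW.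
  by rewrite ler_pdivrMr // mul1r lerDl.
rewrite leNgt; apply/negP => FM.
have U0 := mass_ge0 U.
have J0 : 0 <= eps * J%:R by rewrite mulr_ge0 // ltW.
have h1 : eps * J%:R * (eta / 2 * mass U) <=
    eps * J%:R * (mass F - J%:R * (eta' * (C%:R * mass U))).
  by rewrite ler_wpM2l //; lra.
have U1 : 0 < mass U.
  by apply: lt_le_trans mF; apply: le_lt_trans FM; rewrite mulr_ge0 // ltW.
have := ltr_pM2r U1 (2 * C%:R) (J%:R * (eps * eta)); rewrite Jh; lra.
Qed.

Lemma fringe_density eta F : 0 < eta ->
  (forall i, (i < fringe_levels C eps C.+1 eta)%N -> heavy_fringe i F) ->
  mass F <= eta * mass [set: T].
Proof.
move=> eta0 Fhf; apply: le_trans (_ : eta * mass _ <= _).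
  by apply: (fringe_decay (k := C.+1) eta0 (a := 0) (beta := [::])); rewrite ?addn0.
by rewrite ler_pM2l // massS.
Qed.

End Combinatorics.

(** The selected balls cover [F], and by [separated_multiplicity] with [s = 0] no point lies in more
    than [C] of them. *)
Lemma besicovitch_maximal (R : archiRealFieldType) (T : finType) (d : T -> T -> R)
    (C : nat) (Phi : R) (w phi : T -> R) (r : T -> R) (lam : R) (F : {set T}) :
  colorable_metric d C Phi -> (forall x, 0 <= w x) -> (forall x, 0 <= phi x) -> 0 <= lam ->
  (forall x, x \in F -> 0 <= r x /\
     lam * mass w (cball d x (r x)) <= mass phi (cball d x (r x))) ->
  lam * mass w F <= C%:R * mass phi [set: T].
Proof.
move=> dC w0 phi0 lam0 Fr.
have [x /Fr[]//|S [SF Scov Ssep]] := besicovitch_select dC (F := F) (r := r).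
have [dxx dsym _ Phi0 _] := dC.
apply: (@le_trans _ _ (\sum_(x in S) lam * mass w (cball d x (r x)))).
  rewrite -mulr_sumr ler_wpM2l //; apply: mass_cover => // y /Scov[x xS xy].
  by exists x => //; rewrite inE.
apply: (@le_trans _ _ (\sum_(x in S) mass phi (cball d x (r x)))).
  by apply: ler_sum => x /(subsetP SF)/Fr[].
apply: mass_multiplicity => // y _.
apply: leq_trans (separated_multiplicity dC y (lexx 0) Ssep).
apply/subset_leq_card/subsetP => x; rewrite !inE => /andP[-> xy] /=.
rewrite mulr0; apply/andP; split; last by apply/existsP; exists y; rewrite dxx lexx.
have [_ _ dtri _ _] := dC.
by have := dtri x y x; rewrite dxx (dsym y x); lra.
Qed.

(** * Real inequalities behind the absorption of one ball centre by another *)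

Section ScalarInequalities.
Variable R : realFieldType.
Implicit Types (a b s t k r I J : R).

Lemma le_of_sqr a b : 0 <= b -> a ^+ 2 <= b ^+ 2 -> a <= b.
Proof.
move=> b0; apply: contraTT; rewrite -!ltNge => ba.
by rewrite ltrXn2r // lt0r_neq0 //; lra.
Qed.

Lemma norm_le_of_sqr a b : 0 <= b -> a ^+ 2 <= b ^+ 2 -> `|a| <= b.
Proof. by move=> b0 ab; apply: le_of_sqr; rewrite // real_normK ?num_real. Qed.

Lemma circle_le1 a t : a ^+ 2 + t ^+ 2 = 1 -> `|a| <= 1 /\ `|t| <= 1.
Proof.
move=> at1; have := sqr_ge0 a; have := sqr_ge0 t => ? ?.
by split; apply: norm_le_of_sqr; rewrite // expr1n; lra.
Qed.

(* [a = |z| / N] and [t = tau / N ^ 2] satisfy [a ^ 2 + t ^ 2 = 1].  Two points of this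
   circle are close if they lie in one of three overlapping arcs, with equal signs of
   [t] on those arcs that do not meet [t = 0]; the overlaps absorb perturbations. *)
Definition circle_close a t b s : Prop :=
  [\/ [/\ a ^+ 2 <= 30/100, b ^+ 2 <= 30/100 & 0 <= t * s],
      [/\ 29/100 <= a ^+ 2 <= 80/100, 29/100 <= b ^+ 2 <= 80/100 & 0 <= t * s] |
      79/100 <= a ^+ 2 /\ 79/100 <= b ^+ 2].

(** For [k = r] and perfectly aligned [z]-parts the goal of [ball_absorbs] would need only the
    constants 1 and 2. The factor [103/100] allows for [(k / r) ^ 2], and [192/100] in place of 2
    pays for [k / r], for the defect of [I] and for the terms in [J]. *)
Lemma circle_pair a b t s : 0 <= a -> 0 <= b -> a ^+ 2 + t ^+ 2 = 1 -> b ^+ 2 + s ^+ 2 = 1 ->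
  circle_close a t b s ->
  b ^+ 2 + 103/100 * s ^+ 2 <= 192/100 * (a * b) + 2 * (t * s).
Proof.
move=> a0 b0 at1 bs1; have ab0 := mulr_ge0 a0 b0.
have ts2 : (t * s) ^+ 2 = t ^+ 2 * s ^+ 2 by rewrite exprMn.
have ab2 : (a * b) ^+ 2 = a ^+ 2 * b ^+ 2 by rewrite exprMn.
have b20 := sqr_ge0 b.
case=> [[a3 b3 ts]|[/andP[a1 a2] /andP[b1 b2] ts]|[a1 b1]].
- have ts7 : 7/10 <= t * s.
    apply: le_of_sqr => //; rewrite ts2.
    apply: le_trans (ler_pM _ _ (_ : 7/10 <= t ^+ 2) (_ : 7/10 <= s ^+ 2)); lra.
  lra.
- have ba : b <= 167/100 * a by apply: le_of_sqr; [lra|rewrite exprMn; lra].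
  have st : s ^+ 2 <= 189/100 * (t * s).
    apply: le_of_sqr; first lra.
    rewrite (exprMn 2 (189/100)) ts2; have s2 := sqr_ge0 s.
    have h1 := ler_wpM2r s2 (_ : s ^+ 2 <= 71/100).
    have h2 := ler_wpM2r s2 (_ : 20/100 <= t ^+ 2).
    by rewrite [(s ^+ 2) ^+ 2]expr2; have := h1 ltac:(lra); have := h2 ltac:(lra); lra.
  by have := ler_wpM2r b0 ba; rewrite -mulrA -expr2; lra.
- have ab7 : 79/100 <= a * b.
    apply: le_of_sqr => //; rewrite ab2.
    apply: le_trans (ler_pM _ _ (_ : 79/100 <= a ^+ 2) (_ : 79/100 <= b ^+ 2)); lra.
  have : `|t * s| <= 21/100.
    by apply: norm_le_of_sqr; [lra|rewrite ts2 expr2; apply: ler_pM; rewrite ?sqr_ge0 //; lra].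
  by rewrite ler_norml => /andP[]; lra.
Qed.

(* Expanded form of [N (P Q^-1) <= N P] for [N P = r], [N Q = k], with [I] and [J] the
   real and imaginary parts of [<z_P, z_Q>]. *)
Lemma ball_absorbs a b t s r k I J :
  0 <= a -> 0 <= b -> a ^+ 2 + t ^+ 2 = 1 -> b ^+ 2 + s ^+ 2 = 1 ->
  circle_close a t b s -> 0 < r -> 0 < k -> k <= 101/100 * r ->
  99/100 * ((r * a) * (k * b)) <= I -> `|J| <= 1/100 * ((r * a) * (k * b)) ->
  r ^+ 2 * (k * b) ^+ 2 + (k ^+ 2 * s + J / 2) ^+ 2 <=
  2 * r ^+ 2 * I + 2 * (r ^+ 2 * t) * (k ^+ 2 * s + J / 2).
Proof.
move=> a0 b0 at1 bs1 cls r0 k0 kr hI hJ.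
have core := circle_pair a0 b0 at1 bs1 cls.
have [a1 t1] := circle_le1 at1; have [b1 s1] := circle_le1 bs1.
set m := r * a * (k * b) in hI hJ *.
have m0 : 0 <= m by rewrite /m !mulr_ge0 // ?ltW.
have r20 := sqr_ge0 r; have k20 := sqr_ge0 k.
have rk0 : 0 <= r * k by rewrite mulr_ge0 ?ltW.
have kr2 : r * k <= 101/100 * r ^+ 2 by have := ler_wpM2l (ltW r0) kr; rewrite expr2; lra.
have kk : k ^+ 2 <= 103/100 * r ^+ 2.
  by have := ler_wpM2r (ltW k0) kr; rewrite -[k * k]expr2; lra.
have mrk : m <= r * k.
  rewrite /m (_ : r * a * (k * b) = r * k * (a * b)); last by ring.
  rewrite ler_piMr //; rewrite (ler_norml a) in a1; rewrite (ler_norml b) in b1.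
  by apply: mulr_ile1 => //; lra.
have r2m0 : 0 <= r ^+ 2 * m by rewrite mulr_ge0.
have hSJ : k ^+ 2 * s * J <= 2/100 * (r ^+ 2 * m).
  apply: le_trans (ler_norm _) _; rewrite (normrM (k ^+ 2 * s)) (normrM (k ^+ 2)) (ger0_norm k20).
  apply: (@le_trans _ _ (k ^+ 2 * `|J|)).
    by rewrite ler_wpM2r // ler_piMr.
  apply: le_trans (ler_pM _ _ kk hJ) _ => //; lra.
have hJJ : J ^+ 2 <= 2/100 * (r ^+ 2 * m).
  rewrite -real_normK ?num_real // expr2.
  have h1 : `|J| <= 2/100 * r ^+ 2 by lra.
  apply: le_trans (ler_pM _ _ h1 hJ) _ => //; lra.
have htJ : - (1/100 * (r ^+ 2 * m)) <= r ^+ 2 * t * J.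
  rewrite lerNl; apply: le_trans (ler_norm _) _.
  rewrite normrN (normrM (r ^+ 2 * t)) (normrM (r ^+ 2)) (ger0_norm r20).
  apply: (@le_trans _ _ (r ^+ 2 * `|J|)).
    by rewrite ler_wpM2r // ler_piMr.
  by rewrite [leRHS]mulrCA ler_wpM2l.
have hI' := ler_wpM2l r20 hI.
have h1 : k ^+ 2 * k ^+ 2 * s ^+ 2 <= 103/100 * (r ^+ 2 * k ^+ 2 * s ^+ 2).
  by have := ler_wpM2r (mulr_ge0 k20 (sqr_ge0 s)) kk; lra.
have h2 : r ^+ 2 * k ^+ 2 * (a * b) <= 101/100 * (r ^+ 2 * m).
  have r2kab : 0 <= r ^+ 2 * k * (a * b) by rewrite !mulr_ge0 // ltW.
  by have := ler_wpM2r r2kab kr; rewrite /m !expr2; lra.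
have h3 := ler_wpM2l (mulr_ge0 r20 k20) core.
rewrite [(k ^+ 2 * s + J / 2) ^+ 2]
  (_ : _ = k ^+ 2 * k ^+ 2 * s ^+ 2 + k ^+ 2 * s * J + J ^+ 2 / 4); last by field.
rewrite exprMn; lra.
Qed.

(* The same inequality near the centre of the group, where the direction of [z] is not
   under control. *)
Lemma pole_absorbs t s r k A B I J : 0 < r -> 0 < k -> k <= 101/100 * r ->
  0 <= A -> 0 <= B -> B <= 1/100 * k ^+ 2 -> `|I| <= 1/100 * k ^+ 2 -> `|J| <= 1/100 * k ^+ 2 ->
  A <= 1/100 * r ^+ 2 ->
  r ^+ 2 * A + t ^+ 2 = r ^+ 4 -> k ^+ 2 * B + s ^+ 2 = k ^+ 4 -> 0 <= t * s ->
  r ^+ 2 * B + (s + J / 2) ^+ 2 <= 2 * r ^+ 2 * I + 2 * t * (s + J / 2).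
Proof.
move=> r0 k0 kr A0 B0 Bk Ik Jk Ar hr hk ts0.
have r20 : 0 < r ^+ 2 by rewrite exprn_gt0.
have k20 : 0 < k ^+ 2 by rewrite exprn_gt0.
have kk : k ^+ 2 <= 103/100 * r ^+ 2.
  have := ler_wpM2r (ltW k0) kr; have := ler_wpM2l (ltW r0) kr.
  lra.
rewrite [r ^+ 4](exprM r 2 2) in hr; rewrite [k ^+ 4](exprM k 2 2) in hk.
move: (r ^+ 2) (k ^+ 2) => X Y in r20 k20 kk Bk Ik Jk Ar hr hk *.
have X0 := ltW r20; have Y0 := ltW k20.
have hXB := ler_wpM2l X0 Bk; have hXA := ler_wpM2l X0 Ar; have hYB := ler_wpM2l Y0 Bk.
have XY := mulr_ge0 X0 Y0; have hYY := ler_wpM2l Y0 kk.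
have s2 := sqr_ge0 s; have t2 := sqr_ge0 t.
have hts : 98/100 * (X * Y) <= t * s.
  apply: le_of_sqr => //; rewrite !exprMn.
  have h1 : 99/100 * X ^+ 2 <= t ^+ 2 by rewrite [X ^+ 2]expr2 in hr *; lra.
  have h2 : 99/100 * Y ^+ 2 <= s ^+ 2 by rewrite [Y ^+ 2]expr2 in hk *; lra.
  have X2 := sqr_ge0 X; have Y2 := sqr_ge0 Y; have XY2 := mulr_ge0 X2 Y2.
  have h3 : 99/100 * X ^+ 2 * (99/100 * Y ^+ 2) <= t ^+ 2 * s ^+ 2.
    by apply: ler_pM => //; rewrite mulr_ge0 // divr_ge0.
  lra.
have sY : `|s| <= Y by apply: norm_le_of_sqr; [|have := mulr_ge0 Y0 B0; lra].
have tX : `|t| <= X.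
  apply: norm_le_of_sqr => //; by rewrite -hr lerDr mulr_ge0.
have hsJ : s * J <= 1/100 * (Y * Y).
  apply: le_trans (ler_norm _) _; rewrite normrM.
  by apply: le_trans (ler_pM _ _ sY Jk) _; rewrite ?normr_ge0 // mulrCA.
have htJ : - (1/100 * (X * Y)) <= t * J.
  rewrite lerNl; apply: le_trans (ler_norm _) _; rewrite normrN normrM.
  by apply: le_trans (ler_pM _ _ tX Jk) _; rewrite ?normr_ge0 // mulrCA.
have hJJ : J ^+ 2 <= 1/100 * (Y * Y).
  rewrite -real_normK ?num_real // expr2.
  have JY : `|J| <= Y by lra.
  by rewrite mulrCA; apply: ler_pM.
have hXI : - (1/100 * (X * Y)) <= X * I.
  rewrite lerNl -mulrN mulrCA ler_wpM2l //; apply: le_trans (ler_norm _) _.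
  by rewrite normrN.
have hss : s ^+ 2 <= Y * Y by rewrite -[Y * Y]expr2 -hk lerDr mulr_ge0.
rewrite [(s + J / 2) ^+ 2](_ : _ = s ^+ 2 + s * J + J ^+ 2 / 4); last by field.
lra.
Qed.

End ScalarInequalities.

(** * Stability of arcs, signs and angles under small perturbations *)

Section Perturbation.
Variable R : realFieldType.
Implicit Types (x m s t I J : R).

Lemma sqr_close x x' m s : 0 <= s -> s <= 1/100 * (1/100 * m) -> 0 <= x <= m ->
  `|x' - x| <= 2 * s -> `|x' ^+ 2 - x ^+ 2| <= 1/10 * (1/100 * m ^+ 2).
Proof.
move=> s0 sm /andP[x0 xm] xx; rewrite subr_sqr normrM.
have h : `|x' + x| <= 3 * m.
  by move: xx; rewrite !ler_norml => /andP[? ?]; apply/andP; lra.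
apply: (@le_trans _ _ (2 * s * (3 * m))); first exact: ler_pM.
have m0 : 0 <= m by lra.
by have := ler_wpM2r m0 sm; have := mulr_ge0 m0 m0; rewrite expr2; lra.
Qed.

(* The thresholds lie inside the overlaps of the arcs of [circle_close]. *)
Definition zone x m : bool * bool :=
  (x ^+ 2 <= 59/100 * (1/2 * m ^+ 2), x ^+ 2 <= 159/100 * (1/2 * m ^+ 2)).

Lemma zone_perturb x x' m m' s : 0 <= s -> s <= 1/100 * (1/100 * m) -> 0 <= x <= m ->
  `|x' - x| <= 2 * s -> `|m' - m| <= 2 * s ->
  [/\ (zone x m).1 -> x' ^+ 2 <= 30/100 * m' ^+ 2,
      ~~ (zone x m).1 -> 29/100 * m' ^+ 2 <= x' ^+ 2,
      (zone x m).2 -> x' ^+ 2 <= 80/100 * m' ^+ 2 &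
      ~~ (zone x m).2 -> 79/100 * m' ^+ 2 <= x' ^+ 2].
Proof.
move=> s0 sm xm xx mm; have m0 : 0 <= m by case/andP: xm => *; lra.
have := sqr_close s0 sm xm xx.
have := sqr_close (x := m) s0 sm _ mm; rewrite m0 lexx => /(_ isT).
rewrite !ler_norml => /andP[h1 h2] /andP[h3 h4].
have m2 := sqr_ge0 m.
by rewrite /zone /= -!ltNge; split=> h; lra.
Qed.

(** The bound on [x] keeps [|t|] above [45/100 * m ^ 2], far more than the perturbation, so the sign
    of [t] survives. *)
Lemma sign_perturb x m s t t' : 0 <= s -> s <= 1/100 * (1/100 * m) -> 0 <= m ->
  x ^+ 2 <= 159/100 * (1/2 * m ^+ 2) -> m ^+ 2 * x ^+ 2 + t ^+ 2 = m ^+ 4 ->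
  `|t' - t| <= 2 * (s * m) -> (0 <= t -> 0 <= t') /\ (t < 0 -> t' <= 0).
Proof.
move=> s0 sm m0 xm mt tt.
have m2 := sqr_ge0 m.
have tm : (45/100 * m ^+ 2) ^+ 2 <= t ^+ 2.
  rewrite [m ^+ 4](exprM m 2 2) in mt; have := ler_wpM2l m2 xm.
  by have := sqr_ge0 (m ^+ 2); move: mt; rewrite !exprMn !expr2; lra.
have smm : s * m <= 1/100 * (1/100 * m ^+ 2).
  by have := ler_wpM2r m0 sm; rewrite expr2; lra.
have {}tm : 45/100 * m ^+ 2 <= `|t|.
  by apply: le_of_sqr; rewrite // real_normK ?num_real.
move: tt; rewrite ler_norml => /andP[h1 h2].
by split=> t0; [rewrite ger0_norm // in tm|rewrite ltr0_norm // in tm]; lra.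
Qed.

(* x, y are the norms of two vectors, x', y' those of their perturbations, and
   i, j (resp. I, J) the real and imaginary parts of their inner product. *)
Lemma angle_perturb x y x' y' s i j I J : 0 <= s -> 10 * (100 * s) <= x -> 10 * (100 * s) <= y ->
  0 <= x' <= x + s -> 0 <= y' <= y + 2 * s -> x - s <= x' -> y - 2 * s <= y' ->
  x * y - 1/3 * (1/100 * (x * y)) <= i -> `|j| <= 1/2 * (1/100 * (x * y)) ->
  i - (2 * (x * s) + s * y + 2 * (s * s)) <= I ->
  `|J - j| <= 2 * (x * s) + s * y + 2 * (s * s) ->
  99/100 * (x' * y') <= I /\ `|J| <= 1/100 * (x' * y').
Proof.
move=> s0 sx sy /andP[x'0 xx] /andP[y'0 yy] xx' yy' hi hj hI hJ.
have x0 : 0 <= x by clear -s0 sx; lra.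
have y0 : 0 <= y by clear -s0 sy; lra.
have sx' : 10 * (100 * (s * y)) <= x * y by have := ler_wpM2r y0 sx; clear; lra.
have sy' : 10 * (100 * (x * s)) <= x * y by have := ler_wpM2l x0 sy; clear; lra.
have ss : 10 * (100 * (s * s)) <= x * s by have := ler_wpM2r s0 sx; clear; lra.
have h1 : x' * y' <= (x + s) * (y + 2 * s) by apply: ler_pM.
have h2 : (x - s) * (y - 2 * s) <= x' * y' by clear -s0 sx sy xx' yy'; apply: ler_pM; lra.
have ss0 := mulr_ge0 s0 s0; have xy0 := mulr_ge0 x0 y0.
clear -h1 h2 ss0 xy0 sx' sy' ss hi hj hI hJ; split; first by clear hj hJ; lra.
clear hi hI.
move: hJ hj; rewrite !ler_norml => /andP[? ?] /andP[? ?]; apply/andP; lra.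
Qed.
End Perturbation.

From mathcomp Require Import all_classical all_reals all_analysis.
From mathcomp Require Import measurable_realfun ring lra zify.
Import numFieldNormedType.Exports.
Import Order.TTheory GRing.Theory Num.Theory.
Local Open Scope ring_scope.

(** * The metric of the Heisenberg group *)

Section HeisenbergNorm.
Variables (R : realType) (n : nat).
Implicit Types (p q u v : heis R n) (r s c : R).

Definition hinv p : heis R n := ((fun j => - hx p j, fun j => - hy p j), - ht p).
Definition zdil c p : heis R n := ((fun j => c * hx p j, fun j => c * hy p j), 0).
Definition zsqr p : R := \sum_(j < n) (hx p j ^+ 2 + hy p j ^+ 2).
Definition znorm p : R := Num.sqrt (zsqr p).
Definition redot p q : R := \sum_(j < n) (hx p j * hx q j + hy p j * hy q j).
Definition hnorm p : R := hdist p (@hone R n).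

Lemma zsqr_ge0 p : 0 <= zsqr p.
Proof. by apply: sumr_ge0 => j _; rewrite addr_ge0 ?sqr_ge0. Qed.

Lemma znorm_ge0 p : 0 <= znorm p.
Proof. exact: sqrtr_ge0. Qed.

Lemma znorm_sqr p : znorm p ^+ 2 = zsqr p.
Proof. by rewrite sqr_sqrtr ?zsqr_ge0. Qed.

Lemma redotC p q : redot p q = redot q p.
Proof. by apply: eq_bigr => j _; ring. Qed.

Lemma redotDl p q u : redot (hmul p q) u = redot p u + redot q u.
Proof. by rewrite -big_split; apply: eq_bigr => j _; rewrite /hx /hy /= /hx /hy; ring. Qed.

Lemma redotDr p q u : redot u (hmul p q) = redot u p + redot u q.
Proof. by rewrite redotC redotDl !(redotC u). Qed.

Lemma redotNl p q : redot (hinv p) q = - redot p q.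
Proof. by rewrite -sumrN; apply: eq_bigr => j _; rewrite /hx /hy /= /hx /hy; ring. Qed.

Lemma redotNr p q : redot q (hinv p) = - redot q p.
Proof. by rewrite redotC redotNl redotC. Qed.

Lemma redot_zdil c c' p q : redot (zdil c p) (zdil c' q) = c * c' * redot p q.
Proof. by rewrite mulr_sumr; apply: eq_bigr => j _; rewrite /hx /hy /= /hx /hy; ring. Qed.

Lemma redotpp p : redot p p = zsqr p.
Proof. by apply: eq_bigr => j _; ring. Qed.

Lemma imdotDl p q u : imdot (hmul p q) u = imdot p u + imdot q u.
Proof. by rewrite -big_split; apply: eq_bigr => j _; rewrite /hx /hy /= /hx /hy; ring. Qed.

Lemma imdotC p q : imdot p q = - imdot q p.
Proof. by rewrite -sumrN; apply: eq_bigr => j _; ring. Qed.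

Lemma imdotDr p q u : imdot u (hmul p q) = imdot u p + imdot u q.
Proof. by rewrite imdotC imdotDl !(imdotC u); ring. Qed.

Lemma imdotNl p q : imdot (hinv p) q = - imdot p q.
Proof. by rewrite -sumrN; apply: eq_bigr => j _; rewrite /hx /hy /= /hx /hy; ring. Qed.

Lemma imdotNr p q : imdot q (hinv p) = - imdot q p.
Proof. by rewrite imdotC imdotNl (imdotC q). Qed.

Lemma imdotpp p : imdot p p = 0.
Proof. by rewrite /imdot big1 // => j _; ring. Qed.

Lemma imdot_zdil c c' p q : imdot (zdil c p) (zdil c' q) = c * c' * imdot p q.
Proof. by rewrite mulr_sumr; apply: eq_bigr => j _; rewrite /hx /hy /= /hx /hy; ring. Qed.

Lemma zsqr_mul p q : zsqr (hmul p q) = zsqr p + zsqr q + 2 * redot p q.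
Proof. by rewrite -!redotpp !redotDl !redotDr (redotC q p); ring. Qed.

Lemma zsqr_inv p : zsqr (hinv p) = zsqr p.
Proof. by rewrite -!redotpp redotNl redotNr opprK. Qed.

Lemma znorm_inv p : znorm (hinv p) = znorm p.
Proof. by rewrite /znorm zsqr_inv. Qed.

Lemma redot_sqr_le p q : redot p q ^+ 2 <= zsqr p * zsqr q.
Proof.
set A := zsqr p; set B := zsqr q; set I := redot p q.
have quad c : 0 <= c ^+ 2 * A + 2 * c * I + B.
  have := zsqr_ge0 (hmul (zdil c p) q); rewrite zsqr_mul -redotpp redot_zdil redotpp.
  suff -> : redot (zdil c p) q = c * I by rewrite -/A -/B; lra.
  by rewrite mulr_sumr; apply: eq_bigr => j _; rewrite /hx /hy /= /hx /hy; ring.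
have A0 : 0 <= A := zsqr_ge0 p.
have [A00|An0] := eqVneq A 0.
  have [->|In0] := eqVneq I 0; first by rewrite expr0n A00 mul0r.
  have := quad (- (B + 1) / (2 * I)); rewrite A00 mulr0 add0r.
  rewrite (_ : 2 * _ * I + B = - 1); last by field.
  by rewrite lerNr oppr0 ler10.
have {An0}A0 : 0 < A by rewrite lt0r An0.
have := quad (- I / A).
rewrite (_ : _ + B = B - I ^+ 2 / A); last by field; rewrite gt_eqF.
by rewrite subr_ge0 ler_pdivrMr // mulrC.
Qed.

Lemma redot_le p q : `|redot p q| <= znorm p * znorm q.
Proof.
apply: norm_le_of_sqr; first by rewrite mulr_ge0 ?znorm_ge0.
by rewrite exprMn !znorm_sqr redot_sqr_le.
Qed.

Lemma imdot_le p q : `|imdot p q| <= znorm p * znorm q.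
Proof.
(* The vector [- i z_q], of the same norm, turns the imaginary part into a real part. *)
pose q' : heis R n := ((hy q, fun j => - hx q j), 0).
have -> : imdot p q = redot p q' by apply: eq_bigr => j _; rewrite /hx /hy /= /hx /hy; ring.
have -> : znorm q = znorm q'.
  by congr Num.sqrt; apply: eq_bigr => j _; rewrite /hx /hy /= /hx /hy; ring.
exact: redot_le.
Qed.

Lemma znorm_mul p q : znorm (hmul p q) <= znorm p + znorm q.
Proof.
apply: le_of_sqr; first by rewrite addr_ge0 ?znorm_ge0.
rewrite znorm_sqr zsqr_mul sqrrD !znorm_sqr -mulr_natl.
have := redot_le p q; rewrite ler_norml => /andP[_]; lra.
Qed.

Lemma hnormE p : hnorm p =
  (Num.sqrt 2)^-1 * Num.sqrt (zsqr p + Num.sqrt (zsqr p ^+ 2 + 4 * ht p ^+ 2)).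
Proof.
rewrite /hnorm /hdist.
have -> : zdist2 p (@hone R n) = zsqr p.
  by apply: eq_bigr => j _; rewrite /hx /hy /= !subr0.
have -> : imdot p (@hone R n) = 0.
  by rewrite /imdot big1 // => j _; rewrite /hx /hy /= /hx /hy; ring.
by rewrite mulr0 subr0 /ht subr0.
Qed.

Lemma hnorm_ge0 p : 0 <= hnorm p.
Proof. by rewrite hnormE mulr_ge0 ?invr_ge0 ?sqrtr_ge0. Qed.

Lemma hnorm_sqr p : hnorm p ^+ 2 = (zsqr p + Num.sqrt (zsqr p ^+ 2 + 4 * ht p ^+ 2)) / 2.
Proof.
rewrite hnormE exprMn exprVn !sqr_sqrtr //; first by rewrite mulrC.
by rewrite addr_ge0 ?zsqr_ge0 ?sqrtr_ge0.
Qed.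

Lemma zsqr_le_hnorm p : zsqr p <= hnorm p ^+ 2.
Proof.
rewrite hnorm_sqr ler_pdivlMr // mulr_natr mulr2n lerD2l.
rewrite -[leLHS]ger0_norm ?zsqr_ge0 // -sqrtr_sqr ler_sqrt.
  by rewrite lerDl mulr_ge0 ?sqr_ge0.
by rewrite addr_ge0 ?sqr_ge0 // mulr_ge0 ?sqr_ge0.
Qed.

(** [hnorm p ^ 2] is the nonnegative root [X] of [X ^ 2 - zsqr p * X - ht p ^ 2 = 0]; this quartic
    identity replaces the nested square roots from here on. *)
Lemma hnorm4 p : hnorm p ^+ 2 * zsqr p + ht p ^+ 2 = hnorm p ^+ 4.
Proof.
rewrite [RHS](exprM _ 2 2) hnorm_sqr.
have S0 : 0 <= zsqr p ^+ 2 + 4 * ht p ^+ 2.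
  by rewrite addr_ge0 ?sqr_ge0 // mulr_ge0 ?sqr_ge0.
have := sqr_sqrtr S0; move: (Num.sqrt _) => S hS.
have -> : ((zsqr p + S) / 2) ^+ 2 = (zsqr p ^+ 2 + S ^+ 2 + 2 * zsqr p * S) / 4 by field.
by rewrite hS; field.
Qed.

(** The difference of the two sides factors as [(r ^ 2 - N ^ 2) * (r ^ 2 + N ^ 2 - zsqr p)] with
    [N = hnorm p], and the second factor is positive since [zsqr p <= N ^ 2]. *)
Lemma hnorm_le p r : 0 < r -> (hnorm p <= r) = (r ^+ 2 * zsqr p + ht p ^+ 2 <= r ^+ 4).
Proof.
move=> r0; have h4 := hnorm4 p; have h0 := hnorm_ge0 p; have hA := zsqr_le_hnorm p.
have -> : (hnorm p <= r) = (hnorm p ^+ 2 <= r ^+ 2).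
  by rewrite ler_pXn2r // nnegrE ltW.
have -> : ht p ^+ 2 = hnorm p ^+ 4 - hnorm p ^+ 2 * zsqr p by rewrite -h4; ring.
rewrite -subr_ge0 -[in RHS]subr_ge0.
rewrite (_ : r ^+ 4 - _ = (r ^+ 2 - hnorm p ^+ 2) * (r ^+ 2 + hnorm p ^+ 2 - zsqr p)); last by ring.
rewrite pmulr_lge0 //; have : 0 < r ^+ 2 by rewrite exprn_gt0.
lra.
Qed.

Lemma znorm_le_hnorm p : znorm p <= hnorm p.
Proof. by apply: le_of_sqr; rewrite ?hnorm_ge0 // znorm_sqr zsqr_le_hnorm. Qed.

Lemma ht_le_hnorm p : `|ht p| <= hnorm p ^+ 2.
Proof.
apply: norm_le_of_sqr; first exact: sqr_ge0.
by rewrite -exprM -hnorm4 lerDr mulr_ge0 ?sqr_ge0 ?zsqr_ge0.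
Qed.

Lemma hnorm_inv p : hnorm (hinv p) = hnorm p.
Proof. by rewrite !hnormE zsqr_inv /ht sqrrN. Qed.

End HeisenbergNorm.

(** * The triangle inequality *)

Section Triangle.
Variables (R : realType) (n : nat).
Implicit Types (p q u v : heis R n) (r s c : R).

(** As [imdot p p = 0], the vector [q] may be replaced by [r q - r' p], up to the factor [r], before
    applying Cauchy-Schwarz. The right side is the square norm of that vector, which is small when
    [p] and [q] are nearly aligned. *)
Lemma imdot_sqr_le p q r r' : 0 < r -> zsqr p <= r ^+ 2 ->
  imdot p q ^+ 2 <= r ^+ 2 * zsqr q + r' ^+ 2 * zsqr p - 2 * r * r' * redot p q.
Proof.
move=> r0 pr; have r20 : 0 < r ^+ 2 by rewrite exprn_gt0.
pose h := hmul (zdil r q) (zdil (- r') p).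
have hE : zsqr h = r ^+ 2 * zsqr q + r' ^+ 2 * zsqr p - 2 * r * r' * redot p q.
  by rewrite zsqr_mul -!redotpp !redot_zdil (redotC q p); ring.
have p1 : zsqr (zdil 1 p) = zsqr p by rewrite -!redotpp redot_zdil !mul1r.
have ih : imdot (zdil 1 p) h = r * imdot p q.
  by rewrite imdotDr !imdot_zdil imdotpp; ring.
have := imdot_le (zdil 1 p) h.
rewrite -(ler_pXn2r (n := 2)) ?nnegrE ?mulr_ge0 ?znorm_ge0 ?normr_ge0 //.
rewrite real_normK ?num_real // (exprMn 2 (znorm _)) !znorm_sqr ih p1 exprMn hE => h1.
rewrite -(ler_pM2l r20); apply: le_trans h1 _; rewrite ler_wpM2r // -hE.
exact: zsqr_ge0.
Qed.

Lemma hnorm_mul p q : hnorm (hmul p q) <= hnorm p + hnorm q.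
Proof.
(* The radii are enlarged to be positive, since the argument divides by them and either norm may
   vanish. *)
apply/ler_addgt0Pr => e e0; set r := hnorm p + e / 2; set k := hnorm q + e / 2.
have -> : hnorm p + hnorm q + e = r + k by rewrite /r /k; field.
have [p0 q0] := (hnorm_ge0 p, hnorm_ge0 q).
have r0 : 0 < r by rewrite /r; lra.
have k0 : 0 < k by rewrite /k; lra.
have pr : hnorm p <= r by rewrite /r; lra.
have qk : hnorm q <= k by rewrite /k; lra.
clearbody r k.
have prz : zsqr p <= r ^+ 2.
  by apply: le_trans (zsqr_le_hnorm p) _; rewrite ler_pXn2r ?nnegrE // ltW.
rewrite hnorm_le // in pr; rewrite hnorm_le // in qk.
have hJ := imdot_sqr_le q k r0 prz.
rewrite (hnorm_le _ (addr_gt0 r0 k0)) zsqr_mul.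
have -> : ht (hmul p q) = ht p + ht q + imdot p q / 2 by rewrite /ht /=; ring.
move: (imdot p q) (zsqr p) (zsqr q) (redot p q) (ht p) (ht q) hJ pr qk => J A B I t s hJ hr hk.
have rk0 : 0 < r * k by rewrite mulr_gt0.
pose D := r + k; have D0 : 0 < D by rewrite addr_gt0.
have rD : r <= D by rewrite lerDl ltW.
have kD : k <= D by rewrite lerDr ltW.
(* weighted Cauchy-Schwarz with weights r^2, k^2, 2rk, whose sum is (r + k)^2 *)
have cs : (t + s + J / 2) ^+ 2 <=
    D ^+ 2 * (t ^+ 2 / r ^+ 2 + s ^+ 2 / k ^+ 2 + J ^+ 2 / (8 * r * k)).
  rewrite -subr_ge0.
  rewrite (_ : _ - _ = (k * t / r - r * s / k) ^+ 2 + 2 * r * k * ((t / r - J / 4 / k) ^+ 2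
    + (s / k - J / 4 / r) ^+ 2)); last by rewrite /D; field; rewrite !gt_eqF.
  by apply: addr_ge0; rewrite ?sqr_ge0 //; apply: mulr_ge0; [lra|rewrite addr_ge0 ?sqr_ge0].
have ineq (x y : R) : 0 < x -> x <= D -> D ^+ 2 * (y ^+ 2 / x ^+ 2) <= D ^+ 3 * (y ^+ 2 / x ^+ 3).
  move=> x0 xD; rewrite (_ : _ * (_ / x ^+ 3) = D ^+ 2 * (y ^+ 2 / x ^+ 2) * (D / x)); last first.
    by field; rewrite gt_eqF.
  rewrite ler_peMr //; last by rewrite ler_pdivlMr ?mul1r.
  by apply: mulr_ge0; rewrite ?sqr_ge0 //; apply: mulr_ge0; rewrite ?invr_ge0 ?sqr_ge0.
have h1 := ineq r t r0 rD; have h2 := ineq k s k0 kD.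
have hA : A / r <= r - t ^+ 2 / r ^+ 3.
  rewrite -subr_ge0 (_ : _ - _ = (r ^+ 4 - (r ^+ 2 * A + t ^+ 2)) / r ^+ 3).
    by apply: divr_ge0; [rewrite subr_ge0|rewrite exprn_ge0 ?ltW].
  by field; rewrite gt_eqF.
have hB : B / k <= k - s ^+ 2 / k ^+ 3.
  rewrite -subr_ge0 (_ : _ - _ = (k ^+ 4 - (k ^+ 2 * B + s ^+ 2)) / k ^+ 3).
    by apply: divr_ge0; [rewrite subr_ge0|rewrite exprn_ge0 ?ltW].
  by field; rewrite gt_eqF.
rewrite -/D.
(* Completing [A + B + 2 * I] to [D * (A / r + B / k)] costs the quadratic form of [imdot_sqr_le]
   over [r * k]; the resulting gain [J ^ 2 / (r * k)] pays for the [J ^ 2] in [cs]. *)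
have hAB : D ^+ 2 * (A + B + 2 * I) <=
    D ^+ 3 * (A / r + B / k) - D ^+ 2 * (J ^+ 2 / (r * k)).
  rewrite [leLHS](_ : _ = D ^+ 3 * (A / r + B / k)
     - D ^+ 2 * ((r ^+ 2 * B + k ^+ 2 * A - 2 * r * k * I) / (r * k))); last first.
    by rewrite /D; field; rewrite !gt_eqF.
  by rewrite lerD2l lerN2 ler_wpM2l ?sqr_ge0 // ler_wpM2r // invr_ge0 ltW.
have hD3 : 0 <= D ^+ 3 by rewrite exprn_ge0 // ltW.
have hA' := ler_wpM2l hD3 hA; have hB' := ler_wpM2l hD3 hB.
have J8 : D ^+ 2 * (J ^+ 2 / (8 * r * k)) <= D ^+ 2 * (J ^+ 2 / (r * k)).
  rewrite ler_wpM2l ?sqr_ge0 // ler_wpM2l ?sqr_ge0 // lef_pV2 ?posrE //; last first.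
    by rewrite -mulrA mulr_gt0.
  by rewrite -mulrA; lra.
have -> : D ^+ 4 = D ^+ 3 * r + D ^+ 3 * k by rewrite /D; ring.
lra.
Qed.

End Triangle.

(** * The colouring of the Heisenberg group *)

Section Cells.
Variables (R : realType) (n : nat).
Implicit Types (p q u v : heis R n) (r s c : R).

Let L : nat := 300 * n.+1.

Definition zcoord p (jb : 'I_n * bool) : R := if jb.2 then hx p jb.1 else hy p jb.1.

(** A grid of mesh [1 / L] on the directions [z / |z|], whose coordinates lie in [[-1, 1]], so that
    the truncations are at most [2 * L]. *)
Definition zcell p : {ffun 'I_n * bool -> 'I_(2 * L).+1} :=
  [ffun jb => inord (Num.truncn (L%:R * (zcoord p jb / znorm p + 1)))].

Lemma zcoordE p q : redot p q = \sum_jb zcoord p jb * zcoord q jb.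
Proof.
rewrite -(pair_bigA _ (fun j b => zcoord p (j, b) * zcoord q (j, b))) /=.
by apply: eq_bigr => j _; rewrite big_bool.
Qed.

Lemma zcoord_le p jb : `|zcoord p jb| <= znorm p.
Proof.
apply: norm_le_of_sqr; rewrite ?znorm_ge0 // znorm_sqr -redotpp zcoordE.
rewrite (bigD1 jb) //= -expr2 lerDl; apply: sumr_ge0 => i _.
by rewrite -expr2 sqr_ge0.
Qed.

(** Unit vectors [e], [e'] of one cell satisfy [|e' - e| <= 1/200], since
    [2 * n / L ^ 2 <= (1/200) ^ 2]. Then [Re <e, e'> = 1 - |e' - e| ^ 2 / 2], and
    [Im <e, e'> = Im <e, e' - e>] is at most [|e' - e|]. *)
Lemma zcell_close p q : 0 < znorm p -> 0 < znorm q -> zcell p = zcell q ->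
  znorm p * znorm q - 1/3 * (1/100 * (znorm p * znorm q)) <= redot p q /\
  `|imdot p q| <= 1/2 * (1/100 * (znorm p * znorm q)).
Proof.
move=> p0 q0 pq; have pq0 : 0 < znorm p * znorm q by rewrite mulr_gt0.
have L0 : 0 < L%:R :> R by rewrite ltr0n.
have cut r : r \in Num.real -> `|r| <= 1 -> 0 <= L%:R * (r + 1) <= (2 * L)%:R.
  move=> _; rewrite ler_norml => /andP[r1 r2]; apply/andP; split.
    by apply: mulr_ge0; [exact: ltW|lra].
  by rewrite natrM mulrC; apply: ler_wpM2r; [exact: ltW|lra].
have unitb p' jb : 0 < znorm p' -> `|zcoord p' jb / znorm p'| <= 1.
  by move=> p'0; rewrite normrM normfV (gtr0_norm p'0) ler_pdivrMr // mul1r zcoord_le.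
have close jb : (L%:R * (zcoord q jb / znorm q - zcoord p jb / znorm p)) ^+ 2 <= 1.
  have := congr1 (fun f : {ffun 'I_n * bool -> 'I_(2 * L).+1} => f jb : nat) pq; rewrite !ffunE.
  have /andP[P0 P1] := cut _ (num_real _) (unitb p jb p0).
  have /andP[Q0 Q1] := cut _ (num_real _) (unitb q jb q0).
  have := truncn_itv P0; have := truncn_itv Q0.
  move: (Num.truncn _) (Num.truncn _) => a b /andP[a1 a2] /andP[b1 b2].
  rewrite !inordK ?ltnS; last 2 first.
    by rewrite -(ler_nat R); apply: le_trans a1 Q1.
    by rewrite -(ler_nat R); apply: le_trans b1 P1.
  move=> ba; rewrite ba in b1 b2.
  rewrite -natr1 in a2 b2.
  rewrite -real_normK ?num_real // expr_le1 // ler_norml; apply/andP; lra.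
pose e := zdil (znorm p)^-1 p; pose e' := zdil (znorm q)^-1 q; pose f := hmul e' (hinv e).
have ee : redot e e = 1.
  by rewrite redot_zdil redotpp -znorm_sqr; field; rewrite gt_eqF.
have ee' : redot e' e' = 1.
  by rewrite redot_zdil redotpp -znorm_sqr; field; rewrite gt_eqF.
have fE : zsqr f = 2 - 2 * redot e e'.
  by rewrite zsqr_mul zsqr_inv -!redotpp redotNr ee ee' (redotC e' e); ring.
have fs : zsqr f <= (1/2 * (1/100)) ^+ 2.
  have L2 : 0 < L%:R ^+ 2 :> R by rewrite exprn_gt0.
  rewrite -(ler_pM2l L2) -redotpp zcoordE mulr_sumr.
  apply: (@le_trans _ _ (\sum_(jb : 'I_n * bool) 1)).
    apply: ler_sum => jb _; apply: le_trans (close jb).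
    rewrite exprMn -expr2 ler_pM2l //.
    rewrite (_ : zcoord f jb = zcoord q jb / znorm q - zcoord p jb / znorm p) //.
    by case: jb => j [] /=; rewrite ![_ / _]mulrC.
  rewrite sumr_const card_prod card_ord card_bool /L !natrM -[n.+1]addn1 natrD.
  have : 0 <= n%:R :> R by [].
  move: (n%:R : R) => x x0; have := mulr_ge0 x0 x0.
  rewrite !exprMn !expr2; lra.
have rE : redot p q = znorm p * znorm q * redot e e'.
  by rewrite redot_zdil; field; rewrite !gt_eqF.
have iE : imdot p q = znorm p * znorm q * imdot e f.
  by rewrite imdotDr imdotNr imdotpp subr0 imdot_zdil; field; rewrite !gt_eqF.
split.
  rewrite rE (_ : _ - _ = znorm p * znorm q * (1 - 1/3 * (1/100))); last by field.
  rewrite ler_pM2l //; lra.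
rewrite iE normrM gtr0_norm //.
rewrite (_ : 1/2 * (1/100 * _) = znorm p * znorm q * (1/2 * (1/100))); last by field.
rewrite ler_pM2l //.
apply: le_trans (imdot_le e f) _.
have -> : znorm e = 1 by rewrite /znorm -redotpp ee sqrtr1.
by rewrite mul1r; apply: le_of_sqr; [lra|rewrite znorm_sqr].
Qed.
End Cells.

Section Absorb.
Variables (R : realType) (n : nat).
Implicit Types (p q u v : heis R n) (r s c : R).

Lemma heis_eq p q : hx p =1 hx q -> hy p =1 hy q -> ht p = ht q -> p = q.
Proof.
case: p q => [[x y] t] [[x' y'] t']; rewrite /hx /hy /ht /= => hx hy ->.
by rewrite (funext hx) (funext hy).
Qed.

Lemma hmulK p u : hmul (hmul p u) (hinv u) = p.
Proof.
apply: heis_eq => [j|j|]; rewrite ?[LHS]addrK //.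
rewrite [LHS]/ht /= imdotNr imdotDl imdotpp /ht /=; ring.
Qed.

Lemma hKmul p u : hmul (hinv u) (hmul u p) = p.
Proof.
apply: heis_eq => [j|j|]; rewrite ?[LHS]addKr //.
rewrite [LHS]/ht /= imdotNl imdotDr imdotpp /ht /=; ring.
Qed.

Lemma hnorm_mulr_close p u : `|hnorm (hmul p u) - hnorm p| <= hnorm u.
Proof.
rewrite ler_norml; have := hnorm_mul p u; have := hnorm_mul (hmul p u) (hinv u).
by rewrite hmulK hnorm_inv => *; apply/andP; split; lra.
Qed.

Lemma hnorm_mull_close p u : `|hnorm (hmul u p) - hnorm p| <= hnorm u.
Proof.
rewrite ler_norml; have := hnorm_mul u p; have := hnorm_mul (hinv u) (hmul u p).
by rewrite hKmul hnorm_inv => *; apply/andP; split; lra.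
Qed.

Lemma znorm_mulr_close p u : `|znorm (hmul p u) - znorm p| <= znorm u.
Proof.
rewrite ler_norml; have := znorm_mul p u; have := znorm_mul (hmul p u) (hinv u).
by rewrite hmulK znorm_inv => *; apply/andP; split; lra.
Qed.

Lemma znorm_mull_close p u : `|znorm (hmul u p) - znorm p| <= znorm u.
Proof.
rewrite ler_norml; have := znorm_mul u p; have := znorm_mul (hinv u) (hmul u p).
by rewrite hKmul znorm_inv => *; apply/andP; split; lra.
Qed.

Lemma ht_mulr_close p u s m : hnorm u <= s -> znorm p <= m ->
  `|ht (hmul p u) - ht p| <= s * s + 1/2 * (m * s).
Proof.
move=> us pm; have -> : ht (hmul p u) - ht p = ht u + 1/2 * imdot p u.
  by rewrite {1}/ht /=; ring.
apply: le_trans (ler_normD _ _) _; rewrite normrM ger0_norm; last lra.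
have u0 := hnorm_ge0 u; apply: lerD.
  by apply: le_trans (ht_le_hnorm u) _; rewrite expr2 ler_pM.
rewrite ler_wpM2l //; apply: le_trans (imdot_le _ _) _.
by apply: ler_pM; rewrite ?znorm_ge0 // (le_trans (znorm_le_hnorm _)).
Qed.

Lemma ht_mull_close p u s m : hnorm u <= s -> znorm p <= m ->
  `|ht (hmul u p) - ht p| <= s * s + 1/2 * (m * s).
Proof.
move=> us pm; have -> : ht (hmul u p) - ht p = ht u - 1/2 * imdot p u.
  by rewrite {1}/ht /= (imdotC u); ring.
apply: le_trans (ler_normB _ _) _; rewrite normrM ger0_norm; last lra.
have u0 := hnorm_ge0 u; apply: lerD.
  by apply: le_trans (ht_le_hnorm u) _; rewrite expr2 ler_pM.
rewrite ler_wpM2l //; apply: le_trans (imdot_le _ _) _.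
by apply: ler_pM; rewrite ?znorm_ge0 // (le_trans (znorm_le_hnorm _)).
Qed.

(** Respectively: closeness to the centre of the group, where perturbations may destroy the
    direction of [z]; the sign of [tau]; the arc of the circle; the direction of [z]. *)
Definition hcolor c p :=
  (znorm p <= c, 0 <= ht p, zone (znorm p) (hnorm p), zcell p).

Lemma hnorm_quotient p q : 0 < hnorm p ->
  hnorm p ^+ 2 * zsqr q + (ht q + imdot p q / 2) ^+ 2 <=
    2 * hnorm p ^+ 2 * redot p q + 2 * ht p * (ht q + imdot p q / 2) ->
  hnorm (hmul p (hinv q)) <= hnorm p.
Proof.
move=> p0 h; rewrite hnorm_le // -hnorm4 zsqr_mul zsqr_inv redotNr.
have -> : ht (hmul p (hinv q)) = ht p - (ht q + imdot p q / 2).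
  by rewrite {1}/ht /= imdotNr /ht /=; field.
move: (ht q + _) h => S h.
by rewrite mulrDr mulrDr sqrrB -mulr_natl; lra.
Qed.

(** Since [P Q^-1 = p (v q)^-1], the claim is [d p (v q) <= d p u^-1]. It becomes
    [N (P Q^-1) <= N P], where [P] and [Q] are perturbations of [p] and [q] of size at most [2 * s],
    small compared with both norms. *)
Lemma hcolor_absorbs s c p q u v : 0 <= s -> 10 * (100 * s) <= c ->
  hcolor c p = hcolor c q ->
  100 * c <= hnorm q -> hnorm q <= hnorm p -> hnorm u <= s -> hnorm v <= s ->
  hnorm (hmul (hmul p u) (hinv (hmul (hmul v q) u))) <= hnorm (hmul p u).
Proof.
move=> s0 sc [pqv pqt pq1 pq2 pqc] cq qp us vs.
set P := hmul p u; set Q := hmul (hmul v q) u.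
have [u0 v0 q0] := And3 (hnorm_ge0 u) (hnorm_ge0 v) (hnorm_ge0 q).
have [zu zv] : znorm u <= s /\ znorm v <= s.
  by split; apply: le_trans (znorm_le_hnorm _) _.
have [zu0 zv0] := (znorm_ge0 u, znorm_ge0 v).
have c0 : 0 <= c by clear -s0 sc; lra.
(* If [N q = 0], then [c] and [s] vanish too, and so do all the norms on the way to [Q]. *)
have [q00|qn0] := eqVneq (hnorm q) 0.
  apply: le_trans (hnorm_mul _ _) _; rewrite hnorm_inv.
  have := hnorm_mul (hmul v q) u; have := hnorm_mul v q; rewrite -/Q.
  clear -s0 sc cq us vs q00 u0 v0; lra.
have {qn0}q1 : 0 < hnorm q by rewrite lt0r qn0.
have p1 : 0 < hnorm p := lt_le_trans q1 qp.
have sq' : s <= 1/100 * (1/100 * hnorm q) by clear -s0 sc cq; lra.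
have sp' : s <= 1/100 * (1/100 * hnorm p) by clear -sq' qp; lra.
have zp : 0 <= znorm p <= hnorm p by rewrite znorm_ge0 znorm_le_hnorm.
have zq : 0 <= znorm q <= hnorm q by rewrite znorm_ge0 znorm_le_hnorm.
have NP : `|hnorm P - hnorm p| <= s by apply: le_trans (hnorm_mulr_close p u) us.
have NQ : `|hnorm Q - hnorm q| <= 2 * s.
  have := hnorm_mulr_close (hmul v q) u; have := hnorm_mull_close q v; rewrite -/Q !ler_norml.
  by clear -us vs => /andP[? ?] /andP[? ?]; apply/andP; split; lra.
have ZP : `|znorm P - znorm p| <= s by apply: le_trans (znorm_mulr_close p u) zu.
have ZQ : `|znorm Q - znorm q| <= 2 * s.
  have := znorm_mulr_close (hmul v q) u; have := znorm_mull_close q v; rewrite -/Q !ler_norml.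
  by clear -zu zv => /andP[? ?] /andP[? ?]; apply/andP; split; lra.
have sp1 := ler_wpM2l s0 sp'; have sq1 := ler_wpM2l s0 sq'.
have [sp0 sq0] : 0 <= s * hnorm p /\ 0 <= s * hnorm q by rewrite !mulr_ge0 // ltW.
have TP : `|ht P - ht p| <= 2 * (s * hnorm p).
  by apply: le_trans (ht_mulr_close us (znorm_le_hnorm p)) _; clear -sp1 sp0; lra.
have TQ : `|ht Q - ht q| <= 2 * (s * hnorm q).
  have zvq : znorm (hmul v q) <= s + hnorm q.
    by apply: le_trans (znorm_mul v q) _; apply: lerD => //; exact: znorm_le_hnorm.
  have := ht_mulr_close us zvq; have := ht_mull_close vs (znorm_le_hnorm q); rewrite -/Q !ler_norml.
  by clear -sq1 sq0 => /andP[? ?] /andP[? ?]; apply/andP; split; lra.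
have [NP1 NP2] : hnorm p - s <= hnorm P /\ hnorm P <= hnorm p + s.
  by move: NP; rewrite ler_norml; clear => /andP[? ?]; split; lra.
have [NQ1 NQ2] : hnorm q - 2 * s <= hnorm Q /\ hnorm Q <= hnorm q + 2 * s.
  by move: NQ; rewrite ler_norml; clear => /andP[? ?]; split; lra.
have [ZP1 ZP2] : znorm p - s <= znorm P /\ znorm P <= znorm p + s.
  by move: ZP; rewrite ler_norml; clear => /andP[? ?]; split; lra.
have [ZQ1 ZQ2] : znorm q - 2 * s <= znorm Q /\ znorm Q <= znorm q + 2 * s.
  by move: ZQ; rewrite ler_norml; clear => /andP[? ?]; split; lra.
have P0 : 0 < hnorm P by clear -NP1 sp' p1; lra.
have Q0 : 0 < hnorm Q by clear -NQ1 sq' q1; lra.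
have QP : hnorm Q <= 101/100 * hnorm P by clear -NP1 NQ2 sp' qp p1; lra.
have sgn : (zone (znorm p) (hnorm p)).2 -> 0 <= ht P * ht Q.
  move=> zp2; have zq2 : (zone (znorm q) (hnorm q)).2 by rewrite /= -pq2.
  have mp : hnorm p ^+ 2 * znorm p ^+ 2 + ht p ^+ 2 = hnorm p ^+ 4.
    by rewrite znorm_sqr hnorm4.
  have mq : hnorm q ^+ 2 * znorm q ^+ 2 + ht q ^+ 2 = hnorm q ^+ 4.
    by rewrite znorm_sqr hnorm4.
  have [p3 p4] := sign_perturb s0 sp' (ltW p1) zp2 mp TP.
  have [q3 q4] := sign_perturb s0 sq' (ltW q1) zq2 mq TQ.
  have [tp|tp] := leP 0 (ht p).
    by rewrite mulr_ge0 ?p3 // q3 // -pqt.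
  by rewrite mulr_le0 ?p4 // q4 // ltNge -pqt -ltNge.
apply: hnorm_quotient => //.
have [zP0 zQ0] := (znorm_ge0 P, znorm_ge0 Q).
(* Near the centre [|z|] is at most a hundredth of the norm, so [tau] dominates and equal signs
   suffice; away from it [|z| >= 1000 * s], and the directions survive the perturbation. *)
have [pv|pv] := boolP (znorm p <= c).
  have qv : znorm q <= c by rewrite -pqv.
  have PC : znorm P <= 2 * c by clear -pv ZP2 s0 sc; lra.
  have QC : znorm Q <= 2 * c by clear -qv ZQ2 s0 sc; lra.
  have hP : (90 * c) ^+ 2 <= hnorm P ^+ 2.
    have c9 : 90 * c <= hnorm P by clear -NP1 cq qp s0 sc; lra.
    by rewrite ler_pXn2r // nnegrE ?mulr_ge0 // ltW.
  have hQ : (90 * c) ^+ 2 <= hnorm Q ^+ 2.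
    have c9 : 90 * c <= hnorm Q by clear -NQ1 cq s0 sc; lra.
    by rewrite ler_pXn2r // nnegrE ?mulr_ge0 // ltW.
  have small x y z : 0 <= x -> 0 <= y -> x <= 2 * c -> y <= 2 * c ->
      (90 * c) ^+ 2 <= z -> x * y <= 1/100 * z.
    clear -c0 => x0 y0 xs ys; rewrite expr2 => cz.
    apply: (@le_trans _ _ ((2 * c) * (2 * c))); first exact: ler_pM.
    by have := mulr_ge0 c0 c0; clear -cz; lra.
  apply: (@pole_absorbs _ _ _ (hnorm P) (hnorm Q) (zsqr P)); rewrite ?zsqr_ge0 //.
  - by rewrite -[zsqr _]znorm_sqr [leLHS]expr2; exact: small.
  - by apply: le_trans (redot_le _ _) _; exact: small.
  - by apply: le_trans (imdot_le _ _) _; exact: small.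
  - by rewrite -[zsqr _]znorm_sqr [leLHS]expr2; exact: small.
  - exact: hnorm4.
  - exact: hnorm4.
  - apply: sgn; rewrite /zone /=; apply: (@le_trans _ _ ((1/100 * hnorm p) ^+ 2)).
      have zc : znorm p <= 1/100 * hnorm p by clear -pv cq qp; lra.
      by rewrite ler_pXn2r // nnegrE ?znorm_ge0 // mulr_ge0 // ltW.
    by have := sqr_ge0 (hnorm p); rewrite (exprMn 2 (1/100)); clear; lra.
have qv : ~~ (znorm q <= c) by rewrite -pqv.
move: pv qv; rewrite -!ltNge => pv qv.
have zp0 : 0 < znorm p := le_lt_trans c0 pv.
have zq0 : 0 < znorm q := le_lt_trans c0 qv.
have [ci cj] := zcell_close zp0 zq0 pqc.
have bound (a b : heis R n) x y : znorm a <= x -> znorm b <= y ->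
    (`|redot a b| <= x * y) * (`|imdot a b| <= x * y).
  move=> ax bx; have h : znorm a * znorm b <= x * y by rewrite ler_pM ?znorm_ge0.
  by split; [exact: le_trans (redot_le _ _) h|exact: le_trans (imdot_le _ _) h].
have [pp qq] := (lexx (znorm p), lexx (znorm q)).
have dI : `|redot P Q - redot p q| <= 2 * (znorm p * s) + s * znorm q + 2 * (s * s).
  have -> : redot P Q - redot p q =
      redot p v + redot p u + redot u v + redot u q + redot u u.
    by rewrite /P /Q !(redotDl, redotDr); ring.
  have := (bound p v _ _ pp zv).1; have := (bound p u _ _ pp zu).1.
  have := (bound u v _ _ zu zv).1; have := (bound u q _ _ zu qq).1.
  have := (bound u u _ _ zu zu).1; rewrite !ler_norml.
  by clear => /andP[? ?] /andP[? ?] /andP[? ?] /andP[? ?] /andP[? ?]; apply/andP; split; lra.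
have dJ : `|imdot P Q - imdot p q| <= 2 * (znorm p * s) + s * znorm q + 2 * (s * s).
  have -> : imdot P Q - imdot p q =
      imdot p v + imdot p u + imdot u v + imdot u q + imdot u u.
    by rewrite /P /Q !(imdotDl, imdotDr); ring.
  have := (bound p v _ _ pp zv).2; have := (bound p u _ _ pp zu).2.
  have := (bound u v _ _ zu zv).2; have := (bound u q _ _ zu qq).2.
  have := (bound u u _ _ zu zu).2; rewrite !ler_norml.
  by clear => /andP[? ?] /andP[? ?] /andP[? ?] /andP[? ?] /andP[? ?]; apply/andP; split; lra.
have [hI hJ] : 99/100 * (znorm P * znorm Q) <= redot P Q /\
    `|imdot P Q| <= 1/100 * (znorm P * znorm Q).
  have sp2 : 10 * (100 * s) <= znorm p := le_trans sc (ltW pv).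
  have sq2 : 10 * (100 * s) <= znorm q := le_trans sc (ltW qv).
  apply: (angle_perturb s0 sp2 sq2 _ _ ZP1 ZQ1 ci cj _ dJ).
  - by rewrite zP0.
  - by rewrite zQ0.
  - by move: dI; rewrite ler_norml; clear => /andP[? ?]; lra.
have circ (h : heis R n) : 0 < hnorm h -> (znorm h / hnorm h) ^+ 2 + (ht h / hnorm h ^+ 2) ^+ 2 = 1.
  move=> h0; rewrite (_ : _ + _ = (hnorm h ^+ 2 * znorm h ^+ 2 + ht h ^+ 2) / hnorm h ^+ 4).
    by rewrite znorm_sqr hnorm4 divff // expf_neq0 // gt_eqF.
  by field; rewrite gt_eqF.
have s2 : s <= 2 * s by clear -s0; lra.
have [P1 P2 P3 P4] := zone_perturb s0 sp' zp (le_trans ZP s2) (le_trans NP s2).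
have [Q1 Q2 Q3 Q4] := zone_perturb s0 sq' zq ZQ NQ.
have pq1' : (zone (znorm p) (hnorm p)).1 = (zone (znorm q) (hnorm q)).1 by exact: pq1.
have pq2' : (zone (znorm p) (hnorm p)).2 = (zone (znorm q) (hnorm q)).2 by exact: pq2.
have [P20 Q20] : 0 < hnorm P ^+ 2 /\ 0 < hnorm Q ^+ 2 by rewrite !exprn_gt0.
have tt0 : 0 <= ht P * ht Q -> 0 <= ht P / hnorm P ^+ 2 * (ht Q / hnorm Q ^+ 2).
  by move=> h; rewrite mulrACA -invfM mulr_ge0 // invr_ge0 mulr_ge0 // ltW.
have zle (h : heis R n) x : 0 < hnorm h ^+ 2 -> znorm h ^+ 2 <= x * hnorm h ^+ 2 ->
    (znorm h / hnorm h) ^+ 2 <= x.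
  by move=> h0; rewrite (expr_div_n (znorm h)) ler_pdivrMr.
have zge (h : heis R n) x : 0 < hnorm h ^+ 2 -> x * hnorm h ^+ 2 <= znorm h ^+ 2 ->
    x <= (znorm h / hnorm h) ^+ 2.
  by move=> h0; rewrite (expr_div_n (znorm h)) ler_pdivlMr.
have cc : circle_close (znorm P / hnorm P) (ht P / hnorm P ^+ 2)
                       (znorm Q / hnorm Q) (ht Q / hnorm Q ^+ 2).
  have [z2|z2] := boolP (zone (znorm p) (hnorm p)).2; last first.
    by apply: Or33; split; apply: zge => //; [exact: P4|apply: Q4; rewrite -pq2'].
  have hs := tt0 (sgn z2).
  have [z1|z1] := boolP (zone (znorm p) (hnorm p)).1.
    by apply: Or31; split=> //; apply: zle => //; [exact: P1|apply: Q1; rewrite -pq1'].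
  apply: Or32; split=> //; apply/andP; split.
  - by apply: zge => //; exact: P2.
  - by apply: zle => //; exact: P3.
  - by apply: zge => //; apply: Q2; rewrite -pq1'.
  - by apply: zle => //; apply: Q3; rewrite -pq2'.
have a0 : 0 <= znorm P / hnorm P by rewrite divr_ge0 // ltW.
have b0 : 0 <= znorm Q / hnorm Q by rewrite divr_ge0 // ltW.
have := ball_absorbs a0 b0 (circ P P0) (circ Q Q0) cc P0 Q0 QP.
have -> : hnorm P * (znorm P / hnorm P) = znorm P by rewrite mulrC divfK ?gt_eqF.
have -> : hnorm Q * (znorm Q / hnorm Q) = znorm Q by rewrite mulrC divfK ?gt_eqF.
have -> : hnorm P ^+ 2 * (ht P / hnorm P ^+ 2) = ht P by rewrite mulrC divfK ?gt_eqF.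
have -> : hnorm Q ^+ 2 * (ht Q / hnorm Q ^+ 2) = ht Q by rewrite mulrC divfK ?gt_eqF.
by move=> /(_ _ _ hI hJ); rewrite znorm_sqr.
Qed.
End Absorb.

(** * The discrete Heisenberg group *)

(* The triple (x, y, m) of integers stands for (x + i y, m + <x, y> / 2). *)
Definition dheis (n : nat) : Type := ({ffun 'I_n -> int} * {ffun 'I_n -> int} * int)%type.

Section DiscreteHeisenberg.
Variable n : nat.
Implicit Types g h : dheis n.

Definition ddot (x y : {ffun 'I_n -> int}) : int := \sum_j x j * y j.
Definition dmul g h : dheis n :=
  ([ffun j => g.1.1 j + h.1.1 j], [ffun j => g.1.2 j + h.1.2 j],
   g.2 + h.2 - ddot g.1.2 h.1.1).
Definition dunit : dheis n := ([ffun => 0], [ffun => 0], 0).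
Definition dinv g : dheis n :=
  ([ffun j => - g.1.1 j], [ffun j => - g.1.2 j], - g.2 - ddot g.1.2 g.1.1).

Fact dmulA : associative dmul.
Proof.
move=> g h k; congr (_, _, _) => /=; try by apply/ffunP => j; rewrite !ffunE addrA.
have -> : ddot [ffun j => g.1.2 j + h.1.2 j] k.1.1 = ddot g.1.2 k.1.1 + ddot h.1.2 k.1.1.
  by rewrite -big_split; apply: eq_bigr => j _; rewrite ffunE mulrDl.
have -> : ddot g.1.2 [ffun j => h.1.1 j + k.1.1 j] = ddot g.1.2 h.1.1 + ddot g.1.2 k.1.1.
  by rewrite -big_split; apply: eq_bigr => j _; rewrite ffunE mulrDr.
ring.
Qed.

Fact dmul1g : left_id dunit dmul.
Proof.
move=> [[x y] m]; congr (_, _, _) => /=; try by apply/ffunP => j; rewrite !ffunE add0r.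
by rewrite /ddot big1 ?subr0 ?add0r // => j _; rewrite ffunE mul0r.
Qed.

Fact dmulg1 : right_id dunit dmul.
Proof.
move=> [[x y] m]; congr (_, _, _) => /=; try by apply/ffunP => j; rewrite !ffunE addr0.
by rewrite /ddot big1 ?subr0 ?addr0 // => j _; rewrite ffunE mulr0.
Qed.

Fact dmulVg : left_inverse dunit dinv dmul.
Proof.
move=> [[x y] m]; congr (_, _, _) => /=; try by apply/ffunP => j; rewrite !ffunE addNr.
have -> : ddot [ffun j => - y j] x = - ddot y x.
  by rewrite -sumrN; apply: eq_bigr => j _; rewrite ffunE mulNr.
ring.
Qed.

Fact dmulgV : right_inverse dunit dinv dmul.
Proof.
move=> [[x y] m]; congr (_, _, _) => /=; try by apply/ffunP => j; rewrite !ffunE subrr.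
have -> : ddot y [ffun j => - x j] = - ddot y x.
  by rewrite -sumrN; apply: eq_bigr => j _; rewrite ffunE mulrN.
ring.
Qed.

End DiscreteHeisenberg.

HB.instance Definition _ n := Countable.copy (dheis n)
  ({ffun 'I_n -> int} * {ffun 'I_n -> int} * int)%type.
HB.instance Definition _ n :=
  isGroup.Build (dheis n) (@dmulA n) (@dmul1g n) (@dmulg1 n) (@dmulVg n) (@dmulgV n).

Section Embedding.
Variables (R : realType) (n : nat).
Implicit Types g h : dheis n.

Definition hemb g : heis R n :=
  ((fun j => (g.1.1 j)%:~R, fun j => (g.1.2 j)%:~R),
   g.2%:~R + 2^-1 * \sum_(j < n) (g.1.1 j)%:~R * (g.1.2 j)%:~R).

Lemma hemb_inHd g : inHd (hemb g).
Proof.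
split=> [j|]; first exact: intr_int.
split=> [j|]; first exact: intr_int.
by rewrite /ht /= addrK intr_int.
Qed.

Lemma hemb_surj (p : heis R n) : inHd p -> exists g, hemb g = p.
Proof.
rewrite /inHd /hx /hy /ht => -[px [py pt]].
have fl (z : R) : z \is a Num.int -> (Num.floor z)%:~R = z by move/floorK.
exists (([ffun j => Num.floor (hx p j)], [ffun j => Num.floor (hy p j)],
         Num.floor (ht p - 2^-1 * \sum_(j < n) hx p j * hy p j)) : dheis n).
apply: heis_eq => [j|j|]; rewrite /hx /hy /ht /= ?ffunE ?fl //.
rewrite [X in _ + _ * X](eq_bigr (fun j => p.1.1 j * p.1.2 j)) ?subrK // => j _.
by rewrite !ffunE !fl.
Qed.

Lemma hemb_inj : injective hemb.
Proof.
move=> [[x y] m] [[x' y'] m'] H.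
have hx : x = x'.
  by apply/ffunP => j; apply: (@intr_inj R); have := congr1 (fun p : heis R n => hx p j) H.
have hy : y = y'.
  by apply/ffunP => j; apply: (@intr_inj R); have := congr1 (fun p : heis R n => hy p j) H.
have := congr1 (@ht R n) H; rewrite /ht /= hx hy => /addIr/intr_inj ->.
by [].
Qed.

Lemma hemb1 : hemb 1%g = @hone R n.
Proof.
apply: heis_eq => [j|j|]; rewrite /hx /hy /ht /= ?ffunE //.
by rewrite big1 ?mulr0 ?addr0 // => j _; rewrite ffunE mul0r.
Qed.

(** The halves of [x . y' + y . x'], from the new diagonal term, and of [x . y' - y . x'], from
    [imdot], differ by the integer [y . x'] that [dmul] subtracts. *)
Lemma hembM g h : hemb (g * h)%g = hmul (hemb g) (hemb h).
Proof.
apply: heis_eq => [j|j|]; rewrite /hx /hy /ht /= ?ffunE ?intrD //.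
rewrite /imdot /hx /hy /= /ddot ?intrD rmorphN /= rmorph_sum /=.
rewrite [X in _ + 2^-1 * X = _](eq_bigr (fun j =>
  ((g.1.1 j)%:~R + (h.1.1 j)%:~R) * ((g.1.2 j)%:~R + (h.1.2 j)%:~R))); last first.
  by move=> j _; rewrite !ffunE !intrD.
have -> : \sum_(j < n) ((g.1.1 j)%:~R + (h.1.1 j)%:~R) * ((g.1.2 j)%:~R + (h.1.2 j)%:~R) =
  \sum_(j < n) (g.1.1 j)%:~R * (g.1.2 j)%:~R + \sum_(j < n) (h.1.1 j)%:~R * (h.1.2 j)%:~R +
  \sum_(j < n) (g.1.1 j)%:~R * (h.1.2 j)%:~R + \sum_(j < n) (g.1.2 j)%:~R * (h.1.1 j)%:~R :> R.
  by rewrite -!big_split; apply: eq_bigr => j _ /=; ring.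
have -> : \sum_(j < n) ((g.1.1 j)%:~R * (h.1.2 j)%:~R - (g.1.2 j)%:~R * (h.1.1 j)%:~R) =
  \sum_(j < n) (g.1.1 j)%:~R * (h.1.2 j)%:~R - \sum_(j < n) (g.1.2 j)%:~R * (h.1.1 j)%:~R :> R.
  by rewrite sumrB.
have -> : \sum_i (g.1.2 i * h.1.1 i)%:~R = \sum_(j < n) (g.1.2 j)%:~R * (h.1.1 j)%:~R :> R.
  by apply: eq_bigr => j _; rewrite intrM.
by field.
Qed.

Lemma hembV g : hemb (g^-1)%g = hinv (hemb g).
Proof.
apply: heis_eq => [j|j|]; rewrite /hx /hy /ht /= ?ffunE ?rmorphN //=.
rewrite /ddot rmorphD /= !rmorphN /= rmorph_sum /=.
have -> : \sum_(j < n) ([ffun j => - g.1.1 j] j)%:~R * ([ffun j => - g.1.2 j] j)%:~R =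
  \sum_(j < n) (g.1.1 j)%:~R * (g.1.2 j)%:~R :> R.
  by apply: eq_bigr => j _; rewrite !ffunE !rmorphN /= mulrNN.
have -> : \sum_i (g.1.2 i * g.1.1 i)%:~R = \sum_(j < n) (g.1.1 j)%:~R * (g.1.2 j)%:~R :> R.
  by apply: eq_bigr => j _; rewrite intrM mulrC.
by field.
Qed.

Definition dnorm g : R := hnorm (hemb g).
Definition gdist g h : R := dnorm (g * h^-1)%g.

Lemma dnormV g : dnorm (g^-1)%g = dnorm g.
Proof. by rewrite /dnorm hembV hnorm_inv. Qed.
Lemma dnormM g h : dnorm (g * h)%g <= dnorm g + dnorm h.
Proof. by rewrite /dnorm hembM hnorm_mul. Qed.
Lemma dnorm1 : dnorm 1%g = 0.
Proof.
rewrite /dnorm hemb1 hnormE /zsqr big1 => [|j _]; last by rewrite /hx /hy /= expr0n addr0.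
by rewrite /ht /= !expr0n mulr0 addr0 sqrtr0 addr0 sqrtr0 mulr0.
Qed.

Theorem gdist_colorable : exists C Phi, colorable_metric gdist C Phi.
Proof.
pose ctype := (bool * bool * (bool * bool) * {ffun 'I_n * bool -> 'I_(2 * (300 * n.+1)).+1})%type.
(* The colours are taken with [c = 1000 * s], and [hcolor_absorbs] wants [100 * c <= N q]. *)
exists #|{: ctype}|, (10 * (10 * (10 * 100))); split.
- by move=> g; rewrite /gdist mulgV dnorm1.
- by move=> g h; rewrite /gdist -dnormV invgM invgK.
- by move=> g h k; rewrite /gdist; apply: le_trans (dnormM _ _); rewrite -mulgA mulKg.
- by rewrite !mulr_ge0.
move=> s y s0.
exists (fun g => enum_rank (hcolor (10 * (100 * s)) (hemb (g * y^-1)%g) : ctype)).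
move=> p q u v /enum_rank_inj pq sq qp us vs.
have := @hcolor_absorbs R n s (10 * (100 * s)) (hemb (p * y^-1)%g) (hemb (q * y^-1)%g)
   (hemb (y * u^-1)%g) (hemb (v * q^-1)%g) s0 (lexx _) pq.
rewrite -[hnorm (hemb (q * y^-1)%g)]/(gdist q y) -[hnorm (hemb (p * y^-1)%g)]/(gdist p y).
rewrite -[hnorm (hemb (y * u^-1)%g)]/(gdist y u) -[hnorm (hemb (v * q^-1)%g)]/(gdist v q).
rewrite -!hembM -hembV -hembM.
rewrite [(p * _ * _)%g](_ : _ = (p * u^-1)%g); last by rewrite -mulgA mulKg.
have -> : (v * q^-1 * (q * y^-1) * (y * u^-1) = v * u^-1)%g.
  by rewrite -!mulgA mulKg mulKg.
have -> : (p * u^-1 * (v * u^-1)^-1 = p * v^-1)%g.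
  by rewrite invgM invgK -mulgA mulKg.
apply=> //; first by clear -sq; lra.
by rewrite /gdist -dnormV invgM invgK.
Qed.

End Embedding.

(** * Polynomial growth and enumeration of the balls *)

Lemma expn_gt_linear (a D : nat) : exists i, ((i + a) * D < 2 ^ i)%N.
Proof.
pose l := (a + D.+2)%N; exists (l + l)%N; rewrite expnD.
have h1 : (l < 2 ^ l)%N by rewrite ltn_expl.
have h2 : (4 * D <= 2 ^ l)%N.
  have ha : (0 < 2 ^ a)%N by rewrite expn_gt0.
  have hD : (D < 2 ^ D)%N by rewrite ltn_expl.
  rewrite /l -[D.+2]addn2 !expnD; move: (2 ^ a)%N (2 ^ D)%N ha hD => x y; clear; nia.
have h3 : ((l + l + a) * D <= l * (4 * D))%N.
  by rewrite mulnCA mulnA leq_mul2r; apply/orP; right; rewrite /l; clear; lia.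
apply: leq_ltn_trans h3 _.
by apply: leq_ltn_trans (leq_mul (leqnn l) h2) _; rewrite ltn_mul2r h1 expn_gt0.
Qed.

(** Otherwise [f] more than doubles on every step of length [K], so [2 ^ 2 ^ i <= f (2 ^ i * K)],
    while the polynomial bound gives at most [2 ^ ((i + K + 2) * D)]. *)
Lemma polynomial_growth_doubling (f : nat -> nat) (D : nat) :
  (0 < f 0)%N -> (forall k, f k <= (2 * k).+1 ^ D)%N ->
  forall K, exists N, (f (N + K) <= 2 * f N)%N.
Proof.
move=> f0 fD K; apply: contrapT => /forallNP noN.
have low j : (2 ^ j <= f (j * K))%N.
  elim: j => [|j IHj]; first by rewrite mul0n expn0.
  have h : (2 * f (j * K) < f (j * K + K))%N by rewrite ltnNge; apply/negP; exact: noN.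
  by rewrite mulSn [(K + _)%N]addnC; apply: leq_trans (ltnW h); rewrite expnS leq_mul2l IHj orbT.
have [i hi] := expn_gt_linear (K.+2) D.
have := leq_trans (low (2 ^ i)%N) (fD _); rewrite leqNgt => /negP; apply.
apply: (@leq_ltn_trans ((2 ^ (i + K.+2)) ^ D)%N); last by rewrite -expnM ltn_exp2l.
have [->|D0] := posnP D; first by rewrite !expn0.
rewrite leq_exp2r // expnD; apply: (@leq_trans (2 ^ i * (2 * K.+1))%N); last first.
  by rewrite leq_mul2l expnS leq_mul2l /= ltnW ?orbT // ltn_expl.
have : (0 < 2 ^ i)%N by rewrite expn_gt0.
move: (2 ^ i)%N => z z0; rewrite -[K.+1]addn1 mulnDr muln1 mulnDr; nia.
Qed.

Section Balls.
Variables (R : realType) (n : nat).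
Implicit Types g h : dheis n.

Definition dbox k : finType :=
  ({ffun 'I_n -> 'I_(2 * k).+1} * {ffun 'I_n -> 'I_(2 * k).+1} * 'I_(4 * k ^ 2).+1)%type.
Definition dunbox k (b : dbox k) : dheis n :=
  ([ffun j => (b.1.1 j)%:Z - k%:Z], [ffun j => (b.1.2 j)%:Z - k%:Z], b.2%:Z - (2 * k ^ 2)%N%:Z).
Definition dball k : seq (dheis n) :=
  [seq g <- undup [seq dunbox b | b <- enum (dbox k)] | dnorm R g <= k%:R].

Lemma dball_uniq k : uniq (dball k).
Proof. by rewrite filter_uniq // undup_uniq. Qed.

Lemma int_box (z : int) (k l : nat) : `|z|%:~R <= k%:R :> R ->
  exists i : 'I_(2 * k).+1, (i : nat)%:Z - k%:Z = z.
Proof.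
move=> zk; have {}zk : (`|z| <= k)%N by rewrite -(ler_nat R) natr_absz.
have h : (absz (z + k%:Z)%R < (2 * k).+1)%N by lia.
by exists (Ordinal h); rewrite /=; lia.
Qed.

Lemma mem_dball k g : (g \in dball k) = (dnorm R g <= k%:R).
Proof.
rewrite mem_filter mem_undup; apply/andb_idr => gk.
have k0 : 0 <= k%:R :> R by [].
have zk : znorm (hemb R g) <= k%:R by apply: le_trans (znorm_le_hnorm _) gk.
have coord jb : `|zcoord (hemb R g) jb| <= k%:R.
  exact: le_trans (zcoord_le _ _) zk.
have xk j : `|g.1.1 j|%:~R <= k%:R :> R by rewrite intr_norm; exact: (coord (j, true)).
have yk j : `|g.1.2 j|%:~R <= k%:R :> R by rewrite intr_norm; exact: (coord (j, false)).
have zk2 : zsqr (hemb R g) <= k%:R ^+ 2.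
  by rewrite -znorm_sqr ler_pXn2r // nnegrE // znorm_ge0.
(* The integer [g.2] is [tau - <x, y> / 2], where [|tau| <= k ^ 2] and
   [|<x, y>| <= |z| ^ 2 <= k ^ 2]. *)
have tk : `|g.2|%:~R <= (2 * k ^ 2)%:R :> R.
  have := ht_le_hnorm (hemb R g); rewrite intr_norm.
  have hk2 : hnorm (hemb R g) ^+ 2 <= k%:R ^+ 2 by rewrite ler_pXn2r // nnegrE // hnorm_ge0.
  pose S : R := \sum_(j < n) (g.1.1 j)%:~R * (g.1.2 j)%:~R.
  have S2 : `|S| <= zsqr (hemb R g).
    apply: le_trans (ler_norm_sum _ _ _) _; apply: ler_sum => j _.
    rewrite /hx /hy /= normrM -[in leRHS]real_normK ?num_real //.
    rewrite -[X in _ <= _ + X]real_normK ?num_real //.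
    move: `|_| `|_| (normr_ge0 ((g.1.1 j)%:~R : R)) (normr_ge0 ((g.1.2 j)%:~R : R)) => x y x0 y0.
    by have := sqr_ge0 (x - y); have := sqr_ge0 x; have := sqr_ge0 y; rewrite sqrrB -mulr_natl; lra.
  rewrite /ht /= -/S natrM natrX.
  move: S2; rewrite !ler_norml => /andP[? ?] /andP[? ?]; apply/andP; split; lra.
have [x hx] := choice (fun j => int_box 0 (xk j)).
have [y hy] := choice (fun j => int_box 0 (yk j)).
have [m hm] := int_box 0 tk.
have m4 : (m < (4 * k ^ 2).+1)%N by have := ltn_ord m; clear; lia.
apply/mapP; exists (([ffun j => x j], [ffun j => y j], Ordinal m4) : dbox k).
  by rewrite mem_enum.
rewrite [LHS]surjective_pairing [g.1]surjective_pairing /dunbox /=; congr (_, _, _).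
- by apply/ffunP => j; rewrite !ffunE hx.
- by apply/ffunP => j; rewrite !ffunE hy.
- by rewrite hm.
Qed.

Lemma dball_growth K : exists N, (size (dball (N + K)) <= 2 * size (dball N))%N.
Proof.
apply: (@polynomial_growth_doubling (fun k => size (dball k)) (n + n + 2)).
  by rewrite -has_predT; apply/hasP; exists 1%g => //; rewrite mem_dball dnorm1.
move=> k; rewrite size_filter; apply: leq_trans (count_size _ _) _.
apply: leq_trans (size_undup _) _; rewrite size_map -cardE !card_prod !card_ffun !card_ord.
rewrite 2!expnD; apply: leq_mul; first by [].
rewrite expnS expn1; move: k => k; clear; nia.
Qed.

Lemma sum_Hball (f : heis R n -> R) k :
  \sum_(g \in @Hball R n k) f g = \sum_(g <- dball k) f (hemb R g).
Proof.
have u : uniq (map (@hemb R n) (dball k) : seq (heis R n)).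
  by rewrite map_inj_uniq ?dball_uniq //; exact: hemb_inj.
rewrite -(big_map (@hemb R n) predT f) (fsbig_seq _ _ u).
apply: eq_fsbigl; apply/seteqP; split=> [p [/hemb_surj[g <-] gk]|_ /mapP[g + ->]] /=.
  by apply: map_f; rewrite mem_dball.
by rewrite mem_dball => gk; split; first exact: hemb_inHd.
Qed.
End Balls.

Local Open Scope classical_set_scope.
Local Open Scope ring_scope.

(** * Non-singular actions *)

Lemma density_change_of_variables (R : realType) (d : measure_display)
    (X : measurableType d) (mu : probability X R) (phi psi : X -> X) (om : X -> R) :
  measurable_fun setT phi -> measurable_fun setT psi ->
  cancel phi psi -> cancel psi phi -> measurable_fun setT om -> (forall x, 0 <= om x) ->
  (forall A, measurable A -> mu (phi @` A) = (\int[mu]_(x in A) (om x)%:E)%E) ->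
  forall f : X -> \bar R, measurable_fun setT f -> (forall x, 0 <= f x)%E ->
  (\int[mu]_x (f (phi x) * (om x)%:E) = \int[mu]_x f x)%E.
Proof.
move=> mphi mpsi phiK psiK mom om0 omE f mf f0.
pose psi' : {mfun X >-> X} := HB.pack psi (isMeasurableFun.Build _ _ _ _ psi mpsi).
pose nu := distribution mu psi'.
have nuE A : measurable A -> nu A = (\int[mu]_(x in A) (om x)%:E)%E.
  move=> mA; rewrite -omE // /nu /distribution /pushforward; congr (mu _).
  apply/seteqP; split=> [x Ax|_ [x Ax <-]] /=; last by rewrite phiK.
  by exists (psi x).
have numu : nu `<< mu.
  apply/null_content_dominatesP => A mA A0; rewrite nuE //.
  by apply: null_set_integral => //; exact/measurable_EFinP/measurable_funTS.
have fpsi : (\int[mu]_x f x = \int[nu]_x f (phi x))%E.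
  rewrite ge0_integral_pushforward //=.
  by rewrite preimage_setT; apply: eq_integral => x _ /=; rewrite psiK.
  exact: measurableT_comp.
rewrite fpsi -(Radon_Nikodym_SigmaFinite.change_of_variables numu) //=; last first.
  exact: measurableT_comp.
apply: ae_eq_integral => //.
- by apply: emeasurable_funM; [exact: measurableT_comp|exact/measurable_EFinP].
- apply: emeasurable_funM; first exact: measurableT_comp.
  exact: measurable_int (Radon_Nikodym_SigmaFinite.f_integrable numu).
- apply: ae_eqe_mul2l; apply/ae_eq_sym/integral_ae_eq => //.
  + exact: Radon_Nikodym_SigmaFinite.f_integrable.
  + exact/measurable_EFinP.
  + by move=> A _ mA; rewrite -nuE // -Radon_Nikodym_SigmaFinite.f_integral.
Qed.

Record nonsingular_action (R : realType) (d : measure_display) (X : measurableType d)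
    (mu : probability X R) (G : groupType) (act : G -> X -> X) (om : G -> X -> R) : Prop := {
  group_countable : exists e : nat -> G, forall g, exists i, e i = g;
  act_measurable : forall g, measurable_fun setT (act g);
  act_one : forall x, act 1%g x = x;
  act_mul : forall g h x, act (g * h)%g x = act g (act h x);
  act_nonsingular : forall g A, measurable A -> mu (act g @` A) = 0%E -> mu A = 0%E;
  om_measurable : forall g, measurable_fun setT (om g);
  om_nonneg : forall g x, 0 <= om g x;
  om_density : forall g A, measurable A ->
    mu (act g @` A) = (\int[mu]_(x in A) (om g x)%:E)%E
}.

Section NonsingularAction.
Context (R : realType) (d : measure_display) (X : measurableType d) (mu : probability X R).
Context (G : groupType) (act : G -> X -> X) (om : G -> X -> R).
Hypothesis nsa : nonsingular_action mu act om.

Let act_meas := act_measurable nsa.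
Let act1 := act_one nsa.
Let actM := act_mul nsa.
Let nonsing := act_nonsingular nsa.
Let om_meas := om_measurable nsa.
Let om_ge0 := om_nonneg nsa.
Let omE := om_density nsa.

Lemma actK g : cancel (act g) (act g^-1%g).
Proof. by move=> x; rewrite -actM mulVg act1. Qed.

Lemma actVK g : cancel (act g^-1%g) (act g).
Proof. by move=> x; rewrite -actM mulgV act1. Qed.

Lemma act_image g A : act g @` A = act g^-1%g @^-1` A.
Proof.
apply/seteqP; split=> [_ [x Ax <-]|x Ax] /=; first by rewrite actK.
by exists (act g^-1%g x); rewrite ?actVK.
Qed.

Lemma act_image_meas g A : measurable A -> measurable (act g @` A).
Proof. by move=> mA; rewrite act_image -[_ @^-1` _]setTI; exact: act_meas. Qed.

Lemma om_change g (f : X -> \bar R) : measurable_fun setT f -> (forall x, 0 <= f x)%E ->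
  (\int[mu]_x (f (act g x) * (om g x)%:E) = \int[mu]_x f x)%E.
Proof.
by move=> mf f0; apply: (density_change_of_variables (act_meas g) (act_meas g^-1%g)
  (@actK g) (@actVK g) (om_meas g) (om_ge0 g) (@omE g)).
Qed.

Lemma om_integrable g : mu.-integrable setT (EFin \o om g).
Proof.
apply/integrableP; split; first exact/measurable_EFinP.
under eq_integral => x _ do rewrite gee0_abs ?lee_fin ?om_ge0 //.
by rewrite -omE // (le_lt_trans (probability_le1 _ (act_image_meas g measurableT))) ?ltry.
Qed.

Lemma ae_forall_group (P : G -> X -> Prop) : (forall g, {ae mu, forall x, P g x}) ->
  {ae mu, forall x, forall g, P g x}.
Proof.
have [e e_surj] := group_countable nsa.
move=> aeP; have := ae_foralln (fun i => aeP (e i)).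
by apply: filterS => x Px g; have [i <-] := e_surj g.
Qed.

Lemma om_mul g h : {ae mu, forall x, om (g * h)%g x = om g (act h x) * om h x}.
Proof.
have mgh : measurable_fun setT (fun x => om g (act h x) * om h x).
  by apply: measurable_funM => //; exact: measurableT_comp.
suff : ae_eq mu setT (EFin \o om (g * h)%g) (EFin \o (fun x => om g (act h x) * om h x)).
  by apply: filterS => x /= omx; have [] := omx I.
apply: integral_ae_eq => //; first exact: om_integrable.
  exact/measurable_EFinP.
move=> A _ mA; rewrite -omE //.
have -> : act (g * h)%g @` A = act g @` (act h @` A).
  by rewrite image_comp; congr (_ @` _); apply/funext => x; rewrite actM.
rewrite omE; last exact: act_image_meas.
rewrite [LHS]integral_mkcond [RHS]integral_mkcond -[LHS](om_change h); last 2 first.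
- apply/(measurable_restrictT _ (act_image_meas h mA)).
  exact/measurable_funTS/measurable_EFinP.
- by move=> x; rewrite /patch; case: ifP => // _; rewrite lee_fin.
apply: eq_integral => x _; rewrite /patch.
have -> : (act h x \in act h @` A) = (x \in A).
  rewrite act_image; apply/idP/idP; rewrite !inE /= ?actK //.
by case: ifP => _ /=; rewrite ?mul0e // EFinM.
Qed.

(** The image of the zero set of [om g] has measure equal to the integral of 0, so the zero set is
    null by non-singularity. *)
Lemma om_gt0 g : {ae mu, forall x, 0 < om g x}.
Proof.
pose A := [set x | om g x = 0].
have mA : measurable A.
  rewrite (_ : A = om g @^-1` [set 0]) // -[_ @^-1` _]setTI.
  by apply: om_meas => //; exact: measurable_set1.
exists A; split=> //; last by move=> x /= /negP; rewrite lt0r om_ge0 andbT negbK => /eqP.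
apply: (nonsing (g := g)) => //; rewrite omE //; apply: integral0_eq => x.
by rewrite /A /= => ->.
Qed.

Lemma om1 : {ae mu, forall x, om 1%g x = 1}.
Proof.
have : ae_eq mu setT (EFin \o om 1%g) (EFin \o cst 1).
  apply: integral_ae_eq => //; first exact: om_integrable.
    by apply/measurable_EFinP; exact: measurable_cst.
  move=> A _ mA; rewrite -omE //.
  rewrite [RHS](_ : _ = \int[mu]_(x in A) (cst 1%E) x)%E // integral_cst // mul1e.
  by rewrite act_image invg1; congr (mu _); apply/seteqP; split=> x /=; rewrite act1.
by apply: filterS => x /= omx; have [] := omx I.
Qed.

(** Each cocycle identity holds only almost everywhere; as the group is countable, almost every
    point satisfies all of them, and at such points sums along the orbit can be translated
    exactly. *)
Definition regular_point x :=
  [/\ forall g h, om (g * h)%g x = om g (act h x) * om h x,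
      forall g, 0 < om g x & om 1%g x = 1].

Lemma ae_regular_point : {ae mu, forall x, regular_point x}.
Proof.
have h1 : {ae mu, forall x, forall g h, om (g * h)%g x = om g (act h x) * om h x}.
  by apply: ae_forall_group => g; apply: ae_forall_group => h; exact: om_mul.
have h2 := ae_forall_group om_gt0.
by near=> x; split; near: x; [exact: h1|exact: h2|exact: om1].
Unshelve. all: by end_near. Qed.

(** Integrating the hypothesis gives [|B N| * mu E <= c * |B (N + K)|] times the integral of [f],
    because every translate by the action has the same integral. An [N] with ratio of sizes at most
    2 then suffices. *)
Lemma transference (B : nat -> seq G) (K : nat) (E : set X) (f : X -> R) (c : R) :
  (forall k, exists N, (0 < size (B N))%N /\ (size (B (N + k)) <= 2 * size (B N))%N) ->
  measurable E -> measurable_fun setT f -> (forall x, 0 <= f x) -> 0 <= c ->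
  {ae mu, forall x, forall N,
    \sum_(g <- B N) \1_E (act g x) * om g x <=
    c * \sum_(g <- B (N + K)%N) f (act g x) * om g x} ->
  (mu E <= (2 * c)%:E * \int[mu]_x (f x)%:E)%E.
Proof.
move=> growth mE mf f0 c0 hE; have [N [N0 NK]] := growth K.
have sumE (u : X -> R) M : measurable_fun setT u -> (forall x, 0 <= u x) ->
    (\int[mu]_x (\sum_(g <- B M) u (act g x) * om g x)%:E =
     (size (B M))%:R%:E * \int[mu]_x (u x)%:E)%E.
  move=> mu_ u0; under eq_integral => x _ do rewrite -sumEFin.
  rewrite ge0_integral_sum //; last 2 first.
  - move=> g; apply/measurable_EFinP; apply: measurable_funM => //.
    exact: measurableT_comp.
  - by move=> g x _; rewrite lee_fin mulr_ge0.
  rewrite (eq_bigr (fun=> \int[mu]_x (u x)%:E)%E); last first.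
    have mu' : measurable_fun setT (EFin \o u) by exact/measurable_EFinP.
    by move=> g _; rewrite -[RHS](om_change g mu').
  have iu0 : (0 <= \int[mu]_x (u x)%:E)%E by apply: integral_ge0 => x _; rewrite lee_fin.
  elim: (B M) => [|g s IHs]; first by rewrite big_nil mul0e.
  by rewrite big_cons IHs /= -nat1r EFinD ge0_muleDl ?lee_fin // mul1e.
have m1 : measurable_fun setT (\1_E : X -> R) by exact: measurable_indic.
have ind0 x : 0 <= \1_E x :> R by rewrite indicE.
have int1 : (\int[mu]_x (\1_E x)%:E = mu E)%E by rewrite integral_indic // setIT.
have I0 : (0 <= \int[mu]_x (f x)%:E)%E by apply: integral_ge0 => x _; rewrite lee_fin.
have sum_meas (u : X -> R) M : measurable_fun setT u ->
    measurable_fun setT (fun x => \sum_(g <- B M) u (act g x) * om g x).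
  move=> mu_; apply: measurable_sum => g; apply: measurable_funM => //.
  exact: measurableT_comp.
have : ((size (B N))%:R%:E * mu E <= (size (B N))%:R%:E * ((2 * c)%:E * \int[mu]_x (f x)%:E))%E.
  rewrite -int1 -(sumE _ _ m1 ind0).
  apply: (@le_trans _ _ (\int[mu]_x (c * \sum_(g <- B (N + K)%N) f (act g x) * om g x)%:E)%E).
    apply: ae_ge0_le_integral => //.
    - by move=> x _; rewrite lee_fin sumr_ge0 // => g _; rewrite mulr_ge0 // indicE.
    - by apply/measurable_EFinP; exact: sum_meas.
    - by move=> x _; rewrite lee_fin mulr_ge0 // sumr_ge0 // => g _; rewrite mulr_ge0.
    - by apply/measurable_EFinP; apply: measurable_funM => //; exact: sum_meas.
    - by apply: filterS hE => x + _; rewrite lee_fin.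
  under eq_integral => x _ do rewrite EFinM.
  have sm : measurable_fun setT (fun x => (\sum_(g <- B (N + K)%N) f (act g x) * om g x)%:E).
    by apply/measurable_EFinP; exact: sum_meas.
  have s0 x : setT x -> (0 <= (\sum_(g <- B (N + K)%N) f (act g x) * om g x)%:E)%E.
    by move=> _; rewrite lee_fin sumr_ge0 // => g _; rewrite mulr_ge0.
  rewrite ge0_integralZl //.
  rewrite (sumE _ _ mf f0) !muleA -!EFinM lee_wpmul2r // lee_fin.
  have : (size (B (N + K)))%:R <= 2 * (size (B N))%:R :> R by rewrite -natrM ler_nat.
  move=> /(ler_wpM2l c0); lra.
by rewrite lee_pmul2l // ?lte_fin ?ltr0n.
Qed.

End NonsingularAction.

(** * Balls in a group and sums along an orbit *)

Lemma sum_reindex_seq (R : nmodType) (I J : eqType) (f : I -> J) (f' : J -> I)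
    (s : seq I) (r : seq J) (P : pred I) (Q : pred J) (F : J -> R) :
  cancel f f' -> cancel f' f -> uniq s -> uniq r ->
  (forall i, (f i \in r) && Q (f i) = (i \in s) && P i) ->
  \sum_(j <- r | Q j) F j = \sum_(i <- s | P i) F (f i).
Proof.
move=> fK f'K us ur PQ; rewrite -big_filter -[RHS]big_filter -(big_map f predT).
apply: perm_big; apply: uniq_perm; rewrite ?filter_uniq ?(map_inj_uniq (can_inj fK)) //.
  exact: filter_uniq.
move=> j; rewrite mem_filter andbC -[j]f'K PQ mem_map; last exact: can_inj fK.
by rewrite mem_filter andbC.
Qed.

Lemma sum_ord_nth (R : nmodType) (J : Type) (x0 : J) (s : seq J) (P : pred J) (F : J -> R) :
  \sum_(i < size s | P (nth x0 s i)) F (nth x0 s i) = \sum_(j <- s | P j) F j.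
Proof. by rewrite [RHS](big_nth x0) big_mkord. Qed.

Lemma exists_ord_nth (J : Type) (x0 : J) (s : seq J) (P : pred J) :
  [exists i : 'I_(size s), P (nth x0 s i)] = has P s.
Proof.
apply/existsP/(has_nthP x0) => [[i Pi]|[i ilt Pi]]; first by exists i.
by exists (Ordinal ilt).
Qed.

Record besicovitch_balls (R : archiRealFieldType) (G : groupType) (N : G -> R)
    (B : nat -> seq G) (C : nat) (Phi : R) : Prop := {
  length_one : N 1%g = 0;
  length_inv : forall g, N g^-1%g = N g;
  length_mul : forall g h, N (g * h)%g <= N g + N h;
  ball_uniq : forall k, uniq (B k);
  mem_ball : forall k g, (g \in B k) = (N g <= k%:R);
  ball_growth : forall k, exists M, (size (B (M + k)) <= 2 * size (B M))%N;
  length_colorable : colorable_metric (fun g h => N (g * h^-1)%g) C Phi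
}.

Section BesicovitchBalls.
Context (R : archiRealFieldType) (G : groupType) (N : G -> R) (B : nat -> seq G).
Context (C : nat) (Phi : R).
Hypothesis bb : besicovitch_balls N B C Phi.
Implicit Types (g h u v : G) (k t : nat).

Let N1 := length_one bb.
Let NV := length_inv bb.
Let NM := length_mul bb.
Let memB := mem_ball bb.

Lemma length_ge0 g : 0 <= N g.
Proof. by have := NM g g^-1%g; rewrite mulgV N1 NV; lra. Qed.

Lemma length_divC g h : N (g * h^-1)%g = N (h * g^-1)%g.
Proof. by rewrite -NV invgM invgK. Qed.

Lemma ball_le k k' g : (k <= k')%N -> g \in B k -> g \in B k'.
Proof. by rewrite !memB -(ler_nat R) => kk' gk; exact: le_trans gk kk'. Qed.

Lemma ball_mul k k' g h : g \in B k -> h \in B k' -> (g * h)%g \in B (k + k').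
Proof. by rewrite !memB natrD => gk hk; apply: le_trans (NM _ _) (lerD gk hk). Qed.

Lemma ball_size_gt0 k : (0 < size (B k))%N.
Proof. by rewrite -has_predT; apply/hasP; exists 1%g => //; rewrite memB N1. Qed.

Lemma ball_growth_pos k : exists M, (0 < size (B M))%N /\ (size (B (M + k)) <= 2 * size (B M))%N.
Proof. by have [M hM] := ball_growth bb k; exists M; rewrite ball_size_gt0. Qed.

(** The fringe around the identity, tested on lists: an outer witness is within [t] of a point of
    [B (k + t)], hence in [B (k + t + t)]. *)
Definition ball_fringe t k h : bool :=
  has (fun u => N (u * h^-1)%g <= t%:R) (B k) &&
  has (fun v => (N (v * h^-1)%g <= t%:R) && (k%:R < N v)) (B (k + t + t)).

Lemma ball_fringe_mem t k h : ball_fringe t k h -> h \in B (k + t).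
Proof.
case/andP => /hasP[u uB uh] _; rewrite -[h](mulgVK u) addnC; apply: ball_mul => //.
by rewrite memB length_divC.
Qed.

(** By right-invariance the ball around [g] is [B k * g]; the condition on [L] ensures that the list
    is not too short to contain it. *)
Lemma sum_ball_translate M k L g (F : G -> R) : g \in B M -> (M + k <= L)%N ->
  \sum_(y <- B L | N (g * y^-1)%g <= k%:R) F y = \sum_(h <- B k) F (h * g)%g.
Proof.
move=> gM MkL; apply: (sum_reindex_seq (f' := fun y => (y * g^-1)%g)) => //.
- exact: mulgK.
- exact: mulgVK.
- exact: ball_uniq bb _.
- exact: ball_uniq bb _.
move=> h; rewrite invgM mulgA mulgV mul1g NV -memB andbT; apply: andb_idl => hk.
by apply: ball_le (ball_mul hk gM); rewrite addnC.
Qed.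

Definition seq_fringe (S : seq G) t k g y : bool :=
  has (fun u => (N (u * y^-1)%g <= t%:R) && (N (g * u^-1)%g <= k%:R)) S &&
  has (fun v => (N (v * y^-1)%g <= t%:R) && (k%:R < N (g * v^-1)%g)) S.

Lemma sum_fringe_translate M t k L g (F : G -> R) : g \in B M -> (M + k + t + t <= L)%N ->
  \sum_(y <- B L | seq_fringe (B L) t k g y) F y =
  \sum_(h <- B (k + t) | ball_fringe t k h) F (h * g)%g.
Proof.
move=> gM ML; apply: (sum_reindex_seq (f' := fun y => (y * g^-1)%g)) => //.
- exact: mulgK.
- exact: mulgVK.
- exact: ball_uniq bb _.
- exact: ball_uniq bb _.
have shift u h : (u * (h * g)^-1 = u * g^-1 * h^-1)%g by rewrite invgM mulgA.
have inL k' h : (k' <= k + t + t)%N -> h \in B k' -> (h * g)%g \in B L.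
  move=> k'k hk; apply: ball_le (ball_mul hk gM).
  by apply: leq_trans ML; rewrite addnC -!addnA leq_add2l !addnA.
move=> h; apply/idP/idP => [/andP[_ /andP[/hasP[u _ /andP[uh ug]] /hasP[v _ /andP[vh vg]]]]|].
  have fr : ball_fringe t k h.
    have uB : (u * g^-1)%g \in B k by rewrite memB length_divC.
    have uh' : N (u * g^-1 * h^-1)%g <= t%:R by rewrite -shift.
    have hB : h \in B (k + t).
      rewrite -[h](mulgVK (u * g^-1)%g) addnC; apply: ball_mul => //.
      by rewrite memB length_divC.
    apply/andP; split; first by apply/hasP; exists (u * g^-1)%g.
    apply/hasP; exists (v * g^-1)%g; last by rewrite -shift vh /= length_divC.
    rewrite -[(v * g^-1)%g](mulgVK h) addnC; apply: ball_mul => //.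
    by rewrite memB -shift.
  by rewrite fr (ball_fringe_mem fr).
case/andP=> hB /andP[/hasP[u uB uh] /hasP[v vB /andP[vh vk]]].
rewrite (inL (k + t)%N) ?leq_addr //=; apply/andP; split; apply/hasP.
  exists (u * g)%g; first by apply: (inL k); rewrite // -addnA leq_addr.
  by rewrite shift mulgK uh /= length_divC mulgK -memB.
exists (v * g)%g; first exact: (inL (k + t + t)%N).
by rewrite shift mulgK vh /= length_divC mulgK.
Qed.

Lemma seq_maximal (w phi : G -> R) (r : G -> nat) (lam : R) (S : seq G) (P : pred G) :
  (forall g, 0 <= w g) -> (forall g, 0 <= phi g) -> 0 <= lam ->
  (forall g, g \in S -> P g ->
     lam * (\sum_(y <- S | N (g * y^-1)%g <= (r g)%:R) w y) <=
     \sum_(y <- S | N (g * y^-1)%g <= (r g)%:R) phi y) ->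
  lam * (\sum_(g <- S | P g) w g) <= C%:R * \sum_(g <- S) phi g.
Proof.
move=> w0 phi0 lam0 hS; pose v (i : 'I_(size S)) := nth 1%g S i.
have dv := colorable_metric_comp v (length_colorable bb).
have := @besicovitch_maximal R _ _ C Phi (w \o v) (phi \o v) (fun i => (r (v i))%:R) lam
  [set i | P (v i)]%SET dv.
rewrite /mass /=.
rewrite (eq_bigl (fun i => P (v i))) => [|i]; last by rewrite inE.
rewrite sum_ord_nth (eq_bigl predT) => [|i]; last by rewrite inE.
rewrite (sum_ord_nth 1%g S predT phi); apply => //.
move=> i; rewrite inE => Pi; split=> //; have := hS (v i) (mem_nth _ (ltn_ord i)) Pi.
rewrite -!(sum_ord_nth 1%g); congr (_ * _ <= _); apply: eq_bigl => j; by rewrite inE.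
Qed.

Lemma seq_fringe_density (w : G -> R) (rho : nat -> G -> nat) (rad : nat -> nat)
    (t : nat) (eps eta : R) (S : seq G) (P : pred G) :
  (forall g, 0 <= w g) -> 0 < eps -> 0 < eta -> (t <= rad 0)%N ->
  (forall i, (rad i <= rad i.+1)%N) ->
  (forall i g, (i < fringe_levels C eps C.+1 eta)%N -> g \in S -> P g ->
     [/\ 5 * (Phi + 1) * (rad i)%:R <= (rho i g)%:R, (rho i g <= rad i.+1)%N &
     eps * (\sum_(y <- S | N (g * y^-1)%g <= (rho i g)%:R) w y) <=
     \sum_(y <- S | seq_fringe S t (rho i g) g y) w y]) ->
  \sum_(g <- S | P g) w g <= eta * \sum_(g <- S) w g.
Proof.
move=> w0 eps0 eta0 trad radS hS; pose v (i : 'I_(size S)) := nth 1%g S i.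
have dv := colorable_metric_comp v (length_colorable bb).
have := @fringe_density R _ _ C Phi dv (w \o v) _ (fun i => (rad i)%:R)
  (fun i j => (rho i (v j))%:R) t%:R eps (ler0n _ _) eps0 _ _ eta [set i | P (v i)]%SET eta0.
rewrite /mass /=.
rewrite (eq_bigl (fun i => P (v i))) => [|i]; last by rewrite inE.
rewrite sum_ord_nth (eq_bigl predT) => [|i]; last by rewrite inE.
rewrite (sum_ord_nth 1%g S predT w); apply => // [|i|i iM j].
- by rewrite ler_nat.
- by rewrite ler_nat.
rewrite inE => Pj; have [h1 h2 h3] := hS i (v j) iM (mem_nth _ (ltn_ord j)) Pj.
split=> //; first by rewrite ler_nat.
move: h3; rewrite -!(sum_ord_nth 1%g); congr (_ * _ <= _); apply: eq_bigl => l; rewrite !inE //.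
by rewrite /seq_fringe -!(exists_ord_nth 1%g).
Qed.

End BesicovitchBalls.

(** * The maximal inequality and the negligibility of fringes *)

Lemma measurable_lt_set (R : realType) (d : measure_display) (X : measurableType d)
    (f g : X -> R) : measurable_fun setT f -> measurable_fun setT g ->
  measurable [set x | f x < g x].
Proof.
move=> mf mg; have := measurable_fun_ltr mf mg => /(_ measurableT [set true]).
by rewrite setTI; apply.
Qed.

Lemma measure_bigcup_le (R : realType) (d : measure_display) (X : measurableType d)
    (mu : {measure set X -> \bar R}) (E : nat -> set X) (c : \bar R) :
  (forall k, measurable (E k)) -> {homo E : k l / (k <= l)%N >-> k `<=` l} ->
  (forall k, (mu (E k) <= c)%E) -> (mu (\bigcup_k E k) <= c)%E.
Proof.
move=> mE Ehomo Ec.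
have nd : {homo E : k l / (k <= l)%N >-> (k <= l)%O} by move=> k l /Ehomo/subsetPset.
have cv := @nondecreasing_cvg_mu _ _ _ mu E mE (bigcup_measurable (fun k _ => mE k)) nd.
by rewrite -(cvg_lim _ cv) //; apply: lime_le; [exact: cvgP cv|exact: nearW].
Qed.

Section MaximalInequality.
Context (R : realType) (d : measure_display) (X : measurableType d) (mu : probability X R).
Context (G : groupType) (act : G -> X -> X) (om : G -> X -> R).
Hypothesis nsa : nonsingular_action mu act om.
Context (N : G -> R) (B : nat -> seq G) (C : nat) (Phi : R).
Hypothesis bb : besicovitch_balls N B C Phi.

Definition ball_sum (f : X -> R) k x : R := \sum_(g <- B k) f (act g x) * om g x.
Definition ball_weight k x : R := \sum_(g <- B k) om g x.

Lemma ball_sum_measurable f k : measurable_fun setT f -> measurable_fun setT (ball_sum f k).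
Proof.
move=> mf; apply: measurable_sum => g; apply: measurable_funM; last exact: om_measurable nsa _.
by apply: measurableT_comp => //; exact: act_measurable nsa _.
Qed.

Lemma ball_weight_measurable k : measurable_fun setT (ball_weight k).
Proof. by apply: measurable_sum => g; exact: om_measurable nsa _. Qed.

Lemma om_translate x g h : regular_point act om x ->
  om h (act g x) * om g x = om (h * g)%g x.
Proof. by case=> ->. Qed.

Theorem maximal_inequality (f : X -> R) (lam : R) :
  measurable_fun setT f -> (forall x, 0 <= f x) -> 0 < lam ->
  (mu [set x | exists k, (lam * ball_weight k x < ball_sum f k x)%R] <=
     (2 * (C%:R / lam))%:E * \int[mu]_x (f x)%:E)%E.
Proof.
move=> mf f0 lam0.
pose A k := [set x | lam * ball_weight k x < ball_sum f k x].
have mA k : measurable (A k).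
  apply: measurable_lt_set; last exact: ball_sum_measurable.
  by apply: measurable_funM => //; exact: ball_weight_measurable.
(* Bounded radii keep the balls around [B M] inside [B (M + K)], as transference requires; the bound
   obtained does not depend on [K]. *)
pose E K := \bigcup_(k in [set k | (k <= K)%N]) A k.
have mE K : measurable (E K) by exact: bigcup_measurable.
rewrite (_ : [set x | _] = \bigcup_K E K); last first.
  apply/seteqP; split=> [x [k Ax]|x [K _ [k _ Ax]]]; last by exists k.
  by exists k => //; exists k => /=.
apply: measure_bigcup_le => // [K L KL x [k kK Ax]|K].
  by exists k => //=; apply: leq_trans KL.
have c0 : 0 <= C%:R / lam by rewrite divr_ge0 // ltW.
apply: (transference nsa (ball_growth_pos bb) (mE K) mf f0 c0 (K := K)).
apply: filterS (ae_regular_point nsa) => x regx M.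
have om0 g : 0 <= om g x by exact: om_nonneg nsa _ _.
have kE g : exists k, act g x \in E K -> (k <= K)%N /\ A k (act g x).
  by case: (boolP (act g x \in E K)) => [/[!inE] -[k kK Ak]|_]; [exists k|exists 0%N].
have {kE} [r rE] := choice kE.
have -> : \sum_(g <- B M) \1_(E K) (act g x) * om g x =
    \sum_(g <- B (M + K) | (g \in B M) && (act g x \in E K)) om g x.
  rewrite (@sum_reindex_seq _ _ _ id id (B M) (B (M + K)) (fun g => act g x \in E K)) //.
  - rewrite [RHS]big_mkcond; apply: eq_bigr => g _; rewrite indicE.
    by case: (_ \in _); rewrite ?mul1r ?mul0r.
  - exact: ball_uniq bb _.
  - exact: ball_uniq bb _.
  - move=> g; apply: andb_idl => /andP[gM _].
    exact: ball_le bb _ _ _ (leq_addr _ _) gM.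
rewrite mulrAC ler_pdivlMr // mulrC.
apply: (seq_maximal bb (r := r)) => // [g||g _ /andP[gM gE]].
- by rewrite mulr_ge0.
- exact: ltW.
have [rK Ar] := rE g gE.
rewrite !(sum_ball_translate bb _ gM) ?leq_add2l //.
have := ler_wpM2r (om0 g) (ltW Ar).
rewrite /ball_weight /ball_sum -mulrA !mulr_suml.
rewrite (eq_bigr (fun h => om (h * g)%g x)) => [|h _]; last exact: om_translate.
congr (_ <= _); apply: eq_bigr => h _.
by rewrite -mulrA om_translate // (act_mul nsa).
Qed.

Definition fringe_weight t k x : R :=
  \sum_(g <- B (k + t) | ball_fringe N B t k g) om g x.

Lemma fringe_weight_measurable t k : measurable_fun setT (fringe_weight t k).
Proof.
rewrite (_ : fringe_weight t k =
    fun x => \sum_(g <- B (k + t)) if ball_fringe N B t k g then om g x else 0); last first.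
  by apply/funext => x; rewrite /fringe_weight big_mkcond.
by apply: measurable_sum => g; case: (ball_fringe N B t k g) => //; exact: om_measurable nsa _.
Qed.

Definition heavy t (eps : R) k := [set x | eps * ball_weight k x < fringe_weight t k x].

Lemma heavy_measurable t eps k : measurable (heavy t eps k).
Proof.
apply: measurable_lt_set; last exact: fringe_weight_measurable.
by apply: measurable_funM => //; exact: ball_weight_measurable.
Qed.

(** Transference of [seq_fringe_density] to the orbit: there [D] has density at most [eta], and the
    factor 2 is the loss of [transference]. *)
Lemma heavy_levels_le (D : set X) t (eps eta : R) (rad : nat -> nat) :
  measurable D -> 0 < eps -> 0 < eta -> (t <= rad 0)%N ->
  (forall i, (rad i <= rad i.+1)%N) ->
  (forall i x, (i < fringe_levels C eps C.+1 eta)%N -> D x ->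
     exists k, [/\ 5 * (Phi + 1) * (rad i)%:R <= k%:R, (k <= rad i.+1)%N & heavy t eps k x]) ->
  (mu D <= (2 * eta)%:E)%E.
Proof.
move=> mD eps0 eta0 trad radS hD; set m := fringe_levels _ _ _ _ in hD.
have rad_le i j : (i <= j)%N -> (rad i <= rad j)%N.
  by apply: (homo_leq (r := leq)) => // y x z; exact: leq_trans.
have m1 : measurable_fun setT (cst 1 : X -> R) by exact: measurable_cst.
have h1 (x : X) : 0 <= (cst 1 : X -> R) x by [].
have := transference nsa (ball_growth_pos bb) mD m1 h1 (ltW eta0) (K := (rad m + t + t)%N).
rewrite (_ : \int[mu]_x _ = 1)%E; last first.
  rewrite [LHS](_ : _ = \int[mu]_(x in setT) (cst 1%E) x)%E // integral_cst // mul1e.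
  exact: probability_setT.
rewrite mule1; apply; apply: filterS (ae_regular_point nsa) => x regx M.
have om0 g : 0 <= om g x by exact: om_nonneg nsa _ _.
have kE (ig : nat * G) : exists k, (ig.1 < m)%N -> D (act ig.2 x) ->
    [/\ 5 * (Phi + 1) * (rad ig.1)%:R <= k%:R, (k <= rad ig.1.+1)%N & heavy t eps k (act ig.2 x)].
  have [[i1 D2]|no] := pselect ((ig.1 < m)%N /\ D (act ig.2 x)).
    by have [k hk] := hD _ _ i1 D2; exists k.
  by exists 0%N => i1 D2; case: no.
have {kE} [rho rhoE] := choice kE.
set L := (M + (rad m + t + t))%N.
have -> : \sum_(g <- B M) \1_D (act g x) * om g x =
    \sum_(g <- B L | (g \in B M) && (act g x \in D)) om g x.
  rewrite (@sum_reindex_seq _ _ _ id id (B M) (B L) (fun g => act g x \in D)) //.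
  - rewrite [RHS]big_mkcond; apply: eq_bigr => g _; rewrite indicE.
    by case: (_ \in _); rewrite ?mul1r ?mul0r.
  - exact: ball_uniq bb _.
  - exact: ball_uniq bb _.
  - move=> g; apply: andb_idl => /andP[gM _].
    exact: ball_le bb _ _ _ (leq_addr _ _) gM.
rewrite [X in _ <= _ * X](eq_bigr (fun g => om g x)) => [|g _]; last by rewrite /= mul1r.
apply: (seq_fringe_density bb (rho := fun i g => rho (i, g)) om0 eps0 eta0 trad radS).
move=> i g im _ /andP[gM]; rewrite inE => gD.
have [r1 r2 r3] := rhoE (i, g) im gD; split=> //.
have rm : (rho (i, g) <= rad m)%N by apply: leq_trans r2 (rad_le _ _ _).
rewrite (sum_ball_translate bb _ gM); last first.
  by rewrite /L leq_add2l (leq_trans rm) // -addnA leq_addr.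
rewrite (sum_fringe_translate bb _ gM); last first.
  by rewrite /L -!addnA leq_add2l leq_add2r.
have := ler_wpM2r (om0 g) (ltW r3).
rewrite /ball_weight /fringe_weight -mulrA !mulr_suml.
rewrite (eq_bigr (fun h => om (h * g)%g x)) => [|h _]; last exact: om_translate.
by congr (_ <= _); apply: eq_bigr => h _; rewrite om_translate.
Qed.

Theorem fringe_negligible t (eps : R) : 0 < eps ->
  {ae mu, forall x, exists k0, forall k, (k0 <= k)%N ->
     fringe_weight t k x <= eps * ball_weight k x}.
Proof.
move=> eps0.
pose P a b := \bigcup_(k in [set k | (a <= k < b)%N]) heavy t eps k.
have mP a b : measurable (P a b) by apply: bigcup_measurable => k _; exact: heavy_measurable.
pose E := \bigcap_a \bigcup_(k in [set k | (a <= k)%N]) heavy t eps k.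
have mE : measurable E.
  by apply: bigcap_measurable => // a _; apply: bigcup_measurable => k _; exact: heavy_measurable.
suff E0 : mu E = 0%E.
  exists E; split=> // x /= /forallNP hx a _.
  have /existsNP[k /not_implyP[ak /negP]] := hx a; rewrite -ltNge => hk.
  by exists k.
have Efin : mu E \is a fin_num by exact: fin_num_measure.
apply/eqP/negPn/negP => En0.
pose de := fine (mu E).
have muE : mu E = de%:E by rewrite fineK.
have de0 : 0 < de.
  by rewrite -lte_fin -muE lt0e En0 measure_ge0.
(* With this [eta] the points heavy on all [m] levels have measure at most [de / 4], while [ga] is
   so small that the [m] exceptional sets leave at least [de / 2] of [E]. *)
pose eta := de / 8; have eta0 : 0 < eta by rewrite divr_gt0.
set m := fringe_levels C eps C.+1 eta.
pose ga := de / (2 * m.+1%:R); have ga0 : 0 < ga by rewrite divr_gt0 // mulr_gt0.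
(* Every point of [E] has heavy fringes at arbitrarily large radii, so [E] minus [P a b] decreases
   to the empty set as [b] grows. *)
have bE a : exists b, (mu (E `\` P a b) <= ga%:E)%E.
  apply: contrapT => /forallNP no.
  pose F b := E `\` P a b.
  have mF b : measurable (F b) by exact: measurableD.
  have F0 : \bigcap_b F b = set0.
    apply/seteqP; split=> // x Fx; have [Ex _] := Fx 0%N I.
    have [k ak hk] := Ex a I; have [_] := Fx k.+1 I; apply; exists k => //=.
    by rewrite ak ltnSn.
  have nF : nonincreasing_seq F.
    move=> i j ij; apply/subsetPset => x [Ex nP]; split=> // -[k /andP[ak ki] hk].
    by apply: nP; exists k => //=; rewrite ak (leq_trans ki).
  have cv : mu \o F @ \oo --> 0%E.
    rewrite -(measure0 mu) -F0; apply: nonincreasing_cvg_mu => //.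
      by apply: le_lt_trans (probability_le1 _ (mF 0%N)) _; rewrite ltry.
    exact: bigcap_measurable.
  have : (ga%:E <= limn (mu \o F))%E.
    apply: lime_ge; first exact: cvgP cv.
    by apply: nearW => b; have /negP := no b; rewrite -ltNge => /ltW.
  by rewrite (cvg_lim _ cv) // lee_fin leNgt ga0.
have {bE} [b bE] := choice bE.
pose low r := Num.bound (5 * (Phi + 1) * r%:R).
(* The next scale ends the window of radii that starts at [low], that is, beyond [5 * (Phi + 1)]
   times the present scale. *)
pose rad := nat_rect (fun=> nat) t (fun _ r => maxn r (b (low r))).
have radS i : (rad i <= rad i.+1)%N by rewrite /= leq_maxl.
pose D := nat_rect (fun=> set X) E (fun i A => A `&` P (low (rad i)) (b (low (rad i)))).
have mD j : measurable (D j) by elim: j => //= j mDj; exact: measurableI.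
have DE j : D j `<=` E by elim: j => //= j DjE x [/DjE].
have muD j : (de%:E <= mu (D j) + (j%:R * ga)%:E)%E.
  elim: j => [|j IHj]; first by rewrite mul0r adde0 /= muE.
  apply: (le_trans IHj); rewrite -natr1 mulrDl mul1r EFinD addeA.
  rewrite (addeAC (mu _)); apply: leeD2r.
  have -> : mu (D j) = (mu (D j.+1) + mu (D j `\` P (low (rad j)) (b (low (rad j)))))%E.
    by rewrite addeC; apply: measureDI.
  apply: leeD2l; apply: le_trans (bE (low (rad j))); apply: le_measure; rewrite ?inE.
  - exact: measurableD.
  - exact: measurableD.
  - by move=> x [/DE].
have : (mu (D m) <= (2 * eta)%:E)%E.
  apply: (heavy_levels_le (rad := rad) (t := t) (eps := eps)) => // i x im.
  have DP j : D j x -> forall i, (i < j)%N -> P (low (rad i)) (b (low (rad i))) x.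
    elim: j => // j IHj [/IHj IH Pj] l; rewrite ltnS leq_eqVlt => /orP[/eqP->//|].
    exact: IH.
  move=> /DP/(_ i im)[k /andP[lk kb] hk]; exists k; split=> //.
    have Phi0 : 0 <= Phi by have [] := length_colorable bb.
    apply: le_trans (ltW (archi_boundP _)) _; first by rewrite !mulr_ge0 // addr_ge0.
    by rewrite ler_nat.
  by rewrite /= leq_max (ltnW kb) orbT.
move=> /(leeD2r (m%:R * ga)%:E)/(le_trans (muD m)); rewrite -EFinD lee_fin.
have -> : m%:R * ga = de / 2 * (m%:R / m.+1%:R).
  have m1' : m.+1%:R != 0 :> R by rewrite pnatr_eq0.
  by rewrite /ga; move: (m.+1%:R : R) m1' => z z0; field.
have : m%:R / m.+1%:R <= 1 :> R by rewrite ler_pdivrMr // mul1r ler_nat.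
have de2 : 0 <= de / 2 by rewrite divr_ge0 // ltW.
move=> /(ler_wpM2l de2); rewrite /eta; move: (_ / m.+1%:R) => z; clear -de0 => h1 h2; lra.
Qed.

End MaximalInequality.

(** * Averages of bounded coboundaries *)

Section Coboundaries.
Context (R : realType) (d : measure_display) (X : measurableType d) (mu : probability X R).
Context (G : groupType) (act : G -> X -> X) (om : G -> X -> R).
Hypothesis nsa : nonsingular_action mu act om.
Context (N : G -> R) (B : nat -> seq G) (C : nat) (Phi : R).
Hypothesis bb : besicovitch_balls N B C Phi.

Local Notation regular := (regular_point act om).
Local Notation asum := (ball_sum act om B).
Local Notation weight := (ball_weight om B).

Definition transfer g (h : X -> R) x := h (act g x) * om g x.

Lemma transfer_ge0 g (h : X -> R) : (forall x, 0 <= h x) -> forall x, 0 <= transfer g h x.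
Proof. by move=> h0 x; rewrite mulr_ge0 // (om_nonneg nsa). Qed.

Lemma transfer_measurable g (h : X -> R) :
  measurable_fun setT h -> measurable_fun setT (transfer g h).
Proof.
move=> mh; apply: measurable_funM; last exact: om_measurable nsa _.
by apply: measurableT_comp => //; exact: act_measurable nsa _.
Qed.

Lemma integral_transfer g (h : X -> R) : measurable_fun setT h -> (forall x, 0 <= h x) ->
  (\int[mu]_x (transfer g h x)%:E = \int[mu]_x (h x)%:E)%E.
Proof.
move=> mh h0; have mh' : measurable_fun setT (EFin \o h) by exact/measurable_EFinP.
by rewrite -[RHS](om_change nsa g mh').
Qed.

Lemma regular_act x g : regular x -> regular (act g x).
Proof.
move=> [xM x0 x1]; have actM := act_mul nsa; have ne h : om h x != 0 by rewrite gt_eqF.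
have omV h : om h (act g x) = om (h * g)%g x / om g x by rewrite xM mulfK.
split=> [h k|h|].
- by rewrite !omV -actM -mulgA (xM h) mulrA.
- by rewrite omV divr_gt0.
- by rewrite omV mul1g divff.
Qed.

Lemma weight_gt0 k x : regular x -> 0 < weight k x.
Proof.
move=> [_ x0 _]; rewrite /ball_weight; have := ball_size_gt0 bb k.
case: (B k) => [|g s] // _; rewrite big_cons ltr_pwDl //.
by apply: sumr_ge0 => h _; exact: ltW.
Qed.

Lemma asum_ge0 (f : X -> R) k x : (forall y, 0 <= f y) -> 0 <= asum f k x.
Proof. by move=> f0; apply: sumr_ge0 => g _; rewrite mulr_ge0 // (om_nonneg nsa). Qed.

Lemma asum_split (f1 f2 f : X -> R) k x : regular x ->
  (forall y, regular y -> f y = f1 y + f2 y) -> asum f k x = asum f1 k x + asum f2 k x.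
Proof.
move=> rx fE; rewrite /ball_sum -big_split; apply: eq_bigr => g _ /=.
by rewrite fE ?mulrDl //; exact: regular_act.
Qed.

(** The two sums run over [g * B k] and [B k] with the same summand. A point [y] in only one of
    these sets is within [N g] of [g^-1 * y], and of the two exactly one lies in [B k], so [y]
    belongs to the fringe. *)
Lemma asum_coboundary (h : X -> R) (c : R) g t k x : regular x -> N g <= t%:R ->
  (forall y, 0 <= h y <= c) ->
  `|asum (transfer g h) k x - asum h k x| <= c * fringe_weight om N B t k x.
Proof.
move=> rx gt hc; have om0 a : 0 <= om a x by exact: om_nonneg nsa _ _.
pose phi y := h (act y x) * om y x.
have NV := length_inv bb; have memB := mem_ball bb.
have -> : asum (transfer g h) k x = \sum_(y <- B (k + t) | (g^-1 * y)%g \in B k) phi y.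
  rewrite (@sum_reindex_seq _ _ _ (fun b => g * b)%g (fun y => g^-1 * y)%g (B k) (B (k + t)) predT).
  - apply: eq_bigr => b _; rewrite /phi /transfer (act_mul nsa).
    by rewrite -(om_translate b g rx) mulrA.
  - exact: mulKg.
  - exact: mulVKg.
  - exact: ball_uniq bb _.
  - exact: ball_uniq bb _.
  - move=> b /=; rewrite mulKg andbT; apply: andb_idl => bk.
    by rewrite addnC; apply: (ball_mul bb) => //; rewrite memB.
have -> : asum h k x = \sum_(y <- B (k + t) | y \in B k) phi y.
  rewrite (@sum_reindex_seq _ _ _ id id (B k) (B (k + t)) predT) //.
  - exact: ball_uniq bb _.
  - exact: ball_uniq bb _.
  - move=> b /=; rewrite andbT; apply: andb_idl; exact: ball_le bb _ _ _ (leq_addr _ _).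
rewrite big_mkcond [X in _ - X]big_mkcond -sumrB /fringe_weight.
rewrite [X in _ <= _ * X]big_mkcond mulr_sumr.
rewrite big_seq [leRHS]big_seq.
apply: le_trans (ler_norm_sum _ _ _) _; apply: ler_sum => y yB.
have /andP[hy0 hyc] := hc (act y x).
have phic : `|phi y| <= c * om y x by rewrite ger0_norm ?ler_wpM2r // mulr_ge0.
have rhs0 : 0 <= c * (if ball_fringe N B t k y then om y x else 0).
  by rewrite mulr_ge0 //; [exact: le_trans hy0 hyc|case: ifP].
case: ifP => gy; case: ifP => yk; rewrite ?subrr ?normr0 ?subr0 ?sub0r ?normrN //.
- suff -> : ball_fringe N B t k y by [].
  apply/andP; split; apply/hasP.
    by exists (g^-1 * y)%g; rewrite ?mulgK ?NV.
  exists y; first by apply: ball_le bb _ _ _ (leq_addr _ _) yB.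
  by rewrite mulgV (length_one bb) ler0n /= ltNge -memB yk.
- suff -> : ball_fringe N B t k y by [].
  apply/andP; split; apply/hasP.
    by exists y; rewrite // mulgV (length_one bb).
  exists (g^-1 * y)%g; last by rewrite mulgK NV gt /= ltNge -memB gy.
  by rewrite addnC; apply: (ball_mul bb) => //; rewrite memB NV.
Qed.

Definition small_fringe x := forall t (eps : R), 0 < eps -> exists k0, forall k, (k0 <= k)%N ->
  fringe_weight om N B t k x <= eps * weight k x.

Lemma ae_small_fringe : {ae mu, forall x, small_fringe x}.
Proof.
have h : {ae mu, forall x, forall t j, exists k0, forall k, (k0 <= k)%N ->
    fringe_weight om N B t k x <= j.+1%:R^-1 * weight k x}.
  apply: ae_foralln => t; apply: ae_foralln => j.
  by apply: (fringe_negligible nsa bb); rewrite invr_gt0.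
apply: filterS h => x hx t eps eps0.
have [j jeps] : exists j : nat, j.+1%:R^-1 <= eps.
  exists (Num.bound eps^-1); rewrite -[leRHS]invrK lef_pV2 ?posrE ?invr_gt0 //.
  apply: le_trans (ltW (archi_boundP _)) _; first by rewrite invr_ge0 ltW.
  by rewrite ler_nat.
have [k0 hk0] := hx t j; exists k0 => k /hk0 hk; apply: (le_trans hk).
apply: ler_wpM2r => //; apply: sumr_ge0 => g _; exact: om_nonneg nsa _ _.
Qed.

Lemma asum_coboundary_small (h : X -> R) (c eps : R) g x : regular x -> small_fringe x ->
  (forall y, 0 <= h y <= c) -> 0 < eps -> exists k0, forall k, (k0 <= k)%N ->
  `|asum (transfer g h) k x - asum h k x| <= eps * weight k x.
Proof.
move=> rx sx hc eps0; have c0 : 0 <= c.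
  by have /andP[h0 hc'] := hc x; exact: le_trans h0 hc'.
have gt : N g <= (Num.bound (N g))%:R by apply/ltW/archi_boundP; exact: length_ge0 bb _.
have c1 : 0 < c + 1 by lra.
have [k0 hk0] := sx (Num.bound (N g)) (eps / (c + 1)) (divr_gt0 eps0 c1).
exists k0 => k /hk0 hk; apply: le_trans (asum_coboundary k rx gt hc) _.
apply: le_trans (ler_wpM2l c0 hk) _; rewrite mulrA ler_wpM2r //.
  by rewrite ltW // weight_gt0.
rewrite mulrCA ger_pMr // ler_pdivrMr //; lra.
Qed.

End Coboundaries.

Lemma dominated_decay (R : realType) (d : measure_display) (X : measurableType d)
    (mu : {measure set X -> \bar R}) (u : nat -> X -> R) (v : X -> R) :
  (forall n, measurable_fun setT (u n)) -> mu.-integrable setT (EFin \o v) ->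
  (forall n x, 0 <= u n x <= v x) ->
  {ae mu, forall x, u ^~ x @ \oo --> (0 : R)} ->
  (\int[mu]_x (u n x)%:E)%E @[n --> \oo] --> 0%E.
Proof.
move=> mu_ iv uv u0.
have m1 n : measurable_fun setT (EFin \o u n) by exact/measurable_EFinP.
have m0 : measurable_fun setT (EFin \o cst 0 : X -> \bar R).
  by apply/measurable_EFinP; exact: measurable_cst.
have cv : {ae mu, forall x, setT x -> (EFin \o u n) x @[n --> \oo] --> (EFin \o cst 0) x}.
  by apply: filterS u0 => x hx _; apply: cvg_EFin => //; apply: nearW.
have bd : {ae mu, forall x n, setT x -> (`|(EFin \o u n) x| <= (EFin \o v) x)%E}.
  by apply: aeW => x n _; have /andP[h0 h1] := uv n x; rewrite /= ger0_norm // lee_fin.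
have [_ _] := dominated_convergence measurableT m1 m0 cv iv bd.
by rewrite integral0_eq.
Qed.

Section RatioErgodic.
Context (R : realType) (d : measure_display) (X : measurableType d) (mu : probability X R).
Context (G : groupType) (act : G -> X -> X) (om : G -> X -> R).
Hypothesis nsa : nonsingular_action mu act om.
Hypothesis ergodic : forall A, measurable A -> (forall g, act g @^-1` A = A) ->
  mu A = 0%E \/ mu (~` A) = 0%E.
Context (e : nat -> G).
Hypothesis e_surj : forall g, exists i, e i = g.

Local Notation regular := (regular_point act om).
Local Notation transfer := (transfer act om).

(** * The ratio ergodic theorem *)

(* The largest [h <= p.2] whose translate [ghat h] is below [p.1]. *)
Definition exchange (g : G) (p : (X -> R) * (X -> R)) x : R :=
  Num.min (p.2 x) (transfer g^-1%g p.1 x).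

(** At regular points the difference is already nonnegative, as [exchange_seqE] shows; the maximum
    with 0 ensures nonnegativity at all other points too. *)
Definition exchange_step (g : G) (p : (X -> R) * (X -> R)) : (X -> R) * (X -> R) :=
  (fun x => Num.max 0 (p.1 x - transfer g (exchange g p) x),
   fun x => p.2 x - exchange g p x).

Fixpoint exchange_seq (f : X -> R) (c : R) n : (X -> R) * (X -> R) :=
  if n is n'.+1 then exchange_step (e n') (exchange_seq f c n') else (f, cst c).

Context (f : X -> R) (c : R).
Hypothesis mf : measurable_fun setT f.
Hypothesis f0 : forall x, 0 <= f x.
Hypothesis c0 : 0 <= c.
Hypothesis fc : (\int[mu]_x (f x)%:E = c%:E)%E.

Local Notation P := (exchange_seq f c).
Local Notation h n := (exchange (e n) (P n)).

Lemma exchange_seq_ge0 n x : 0 <= (P n).1 x /\ 0 <= (P n).2 x.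
Proof.
elim: n x => [|n IHn] x //=; split; first by rewrite le_max lexx.
by rewrite subr_ge0 /exchange ge_min lexx.
Qed.

Lemma exchange_ge0 n x : 0 <= h n x.
Proof.
rewrite /exchange le_min (exchange_seq_ge0 n x).2 /=.
by apply: (transfer_ge0 nsa) => y; exact: (exchange_seq_ge0 n y).1.
Qed.

Lemma exchange_seq_meas n :
  measurable_fun setT (P n).1 /\ measurable_fun setT (P n).2.
Proof.
elim: n => [|n [IH1 IH2]] /=; first by split=> //; exact: measurable_cst.
have mh : measurable_fun setT (h n).
  by apply: measurable_minr => //; exact: (transfer_measurable nsa).
split; last exact: measurable_funB.
apply: measurable_maxr; first exact: measurable_cst.
by apply: measurable_funB => //; exact: (transfer_measurable nsa).
Qed.

Lemma exchange_meas n : measurable_fun setT (h n).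
Proof.
have [m1 m2] := exchange_seq_meas n.
by apply: measurable_minr => //; exact: (transfer_measurable nsa).
Qed.

Lemma exchange_seq2_le n x : (P n.+1).2 x <= (P n).2 x.
Proof. by rewrite /= gerBl exchange_ge0. Qed.

Lemma exchange_seq1_le n x : (P n.+1).1 x <= (P n).1 x.
Proof.
rewrite /= ge_max (exchange_seq_ge0 n x).1 gerBl.
by apply: (transfer_ge0 nsa) => y; exact: exchange_ge0.
Qed.

Lemma exchange_seq_le n m x : (n <= m)%N ->
  (P m).1 x <= (P n).1 x /\ (P m).2 x <= (P n).2 x.
Proof.
move=> nm; split.
  apply: (homo_leq (f := fun i => (P i).1 x) (r := fun a b => b <= a)) nm => //.
    by move=> a b z ab bz; exact: le_trans bz ab.
  by move=> i; exact: exchange_seq1_le.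
apply: (homo_leq (f := fun i => (P i).2 x) (r := fun a b => b <= a)) nm => //.
  by move=> a b z ab bz; exact: le_trans bz ab.
by move=> i; exact: exchange_seq2_le.
Qed.

(** Exchanging against a constant makes all the coboundaries bounded, whatever the size of [f]. *)
Lemma exchange_le n x : 0 <= h n x <= c.
Proof.
rewrite exchange_ge0 /=; apply: le_trans (exchange_seq_le x (leq0n n)).2.
by rewrite /exchange ge_min lexx.
Qed.

Lemma regular_transferK g (u : X -> R) x : regular x -> transfer g (transfer g^-1%g u) x = u x.
Proof.
move=> [xM _ x1]; rewrite /transfer -(act_mul nsa) mulVg (act_one nsa) -mulrA -xM mulVg x1.
by rewrite mulr1.
Qed.

Lemma exchange_seqE n x : regular x -> (P n).1 x = (P n.+1).1 x + transfer (e n) (h n) x.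
Proof.
move=> rx /=; rewrite max_r ?subrK // subr_ge0.
rewrite -[leRHS](regular_transferK (e n) _ rx); apply: ler_wpM2r.
  exact: om_nonneg nsa _ _.
by rewrite /exchange ge_min lexx orbT.
Qed.

(** Each step subtracts [transfer g h] from one component and [h] from the other, and these have
    equal, finite integrals. *)
Lemma integral_exchange_seq n :
  (\int[mu]_x ((P n).1 x)%:E = \int[mu]_x ((P n).2 x)%:E)%E /\
  (\int[mu]_x ((P n).1 x)%:E < +oo)%E.
Proof.
have intD (u v w : X -> R) : measurable_fun setT u -> measurable_fun setT v ->
    measurable_fun setT w -> (forall x, 0 <= u x) -> (forall x, 0 <= v x) -> (forall x, 0 <= w x) ->
    {ae mu, forall x, u x = v x + w x} ->
    (\int[mu]_x (u x)%:E = \int[mu]_x (v x)%:E + \int[mu]_x (w x)%:E)%E.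
  move=> m1 m2 m3 u0 v0 w0 E.
  have v0' x : setT x -> (0 <= (v x)%:E)%E by rewrite lee_fin.
  have w0' x : setT x -> (0 <= (w x)%:E)%E by rewrite lee_fin.
  have m1' : measurable_fun setT (EFin \o u) by exact/measurable_EFinP.
  have m2' : measurable_fun setT (EFin \o v) by exact/measurable_EFinP.
  have m3' : measurable_fun setT (EFin \o w) by exact/measurable_EFinP.
  rewrite -ge0_integralD //; apply: ae_eq_integral => //.
    exact: emeasurable_funD.
  by apply: filterS E => x -> _; rewrite EFinD.
elim: n => [|n IHn].
  rewrite [in X in (_ < X)%E]/= fc ltry; split=> //.
  rewrite /= [RHS](_ : _ = \int[mu]_(x in setT) (cst c%:E) x)%E // integral_cst //.
  by rewrite [X in (_ * X)%E]probability_setT mule1.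
have [IHe IHfin] := IHn.
have [m1 m2] := exchange_seq_meas n; have [n1 n2] := exchange_seq_meas n.+1.
have mh := exchange_meas n; have mth := transfer_measurable nsa (e n) mh.
have th0 := transfer_ge0 nsa (e n) (exchange_ge0 n).
have E1 := intD _ _ _ m1 n1 mth (fun x => (exchange_seq_ge0 n x).1)
  (fun x => (exchange_seq_ge0 n.+1 x).1) th0 _.
have E2 := intD _ _ _ m2 n2 mh (fun x => (exchange_seq_ge0 n x).2)
  (fun x => (exchange_seq_ge0 n.+1 x).2) (exchange_ge0 n) _.
have {}E1 := E1 (filterS (fun x rx => exchange_seqE n rx) (ae_regular_point nsa)).
have {}E2 := E2 (aeW mu (fun x => esym (subrK (h n x) ((P n).2 x)))).
rewrite (integral_transfer nsa (e n) mh (exchange_ge0 n)) in E1.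
have fin1 : (\int[mu]_x ((P n.+1).1 x)%:E < +oo)%E.
  apply: le_lt_trans IHfin; rewrite E1 leeDl //; apply: integral_ge0 => x _.
  by rewrite lee_fin exchange_ge0.
split=> //.
have finh : (\int[mu]_x (h n x)%:E)%E \is a fin_num.
  rewrite ge0_fin_numE; last by apply: integral_ge0 => x _; rewrite lee_fin exchange_ge0.
  apply: le_lt_trans IHfin; rewrite E1 leeDr //; apply: integral_ge0 => x _.
  by rewrite lee_fin (exchange_seq_ge0 n.+1 x).1.
by move: IHe; rewrite E1 E2 => /(congr1 (fun z => z - \int[mu]_x (h n x)%:E)%E); rewrite !addeK.
Qed.

(* On [Z] the first components decrease to 0.  If some [g x] is not in [Z], then the step
   for [g^-1] has exhausted the second component at [x].  By ergodicity one of the two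
   components decreases to 0 almost everywhere, and their integrals agree. *)
Lemma exchange_seq_decay : (\int[mu]_x ((P n).1 x)%:E)%E @[n --> \oo] --> 0%E.
Proof.
pose Z := \bigcap_j \bigcup_n [set x | (P n).1 x < j.+1%:R^-1].
have mZ : measurable Z.
  apply: bigcap_measurable => // j _; apply: bigcup_measurable => n _.
  apply: measurable_lt_set; first exact: (exchange_seq_meas n).1.
  exact: measurable_cst.
(* The points whose whole orbit lies in [Z]; unlike [Z], this set is strictly invariant. *)
pose V := \bigcap_i act (e i) @^-1` Z.
have VE x : V x <-> forall g, Z (act g x).
  split=> [Vx g|Zx i _]; last exact: Zx.
  by have [i <-] := e_surj g; exact: Vx.
have mV : measurable V.
  apply: bigcap_measurable => // i _; rewrite -[_ @^-1` _]setTI.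
  exact: act_measurable nsa _ _ _ mZ.
have invV g : act g @^-1` V = V.
  apply/seteqP; split=> x /= /VE hx; apply/VE => h.
    by have := hx (h * g^-1)%g; rewrite -(act_mul nsa) mulgVK.
  by rewrite -(act_mul nsa).
have ge0 := exchange_seq_ge0; have ile n x := exchange_seq_le x (leq0n n).
have [V0|V0] := ergodic mV invV; last first.
  have fint : mu.-integrable setT (EFin \o f).
    apply/integrableP; split; first exact/measurable_EFinP.
    under eq_integral => x _ do rewrite gee0_abs ?lee_fin ?f0 //.
    by rewrite fc ltry.
  apply: (dominated_decay _ fint) => [n|n x|].
  - exact: (exchange_seq_meas n).1.
  - by rewrite (ge0 n x).1 (ile n x).1.
  exists (~` V); split=> //; first exact: measurableC.
  move=> x /= ncv /VE Vx; apply: ncv; apply/cvgrPdist_le => eps eps0.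
  have [j jeps] : exists j : nat, j.+1%:R^-1 <= eps.
    exists (Num.bound eps^-1); rewrite -[leRHS]invrK lef_pV2 ?posrE ?invr_gt0 //.
    apply: le_trans (ltW (archi_boundP _)) _; first by rewrite invr_ge0 ltW.
    by rewrite ler_nat.
  have [n _ hn] := Vx 1%g j I; rewrite /= (act_one nsa) in hn.
  exists n => // m /= nm; rewrite sub0r normrN ger0_norm; last exact: (ge0 m x).1.
  by apply: le_trans jeps; apply: le_trans (ltW hn); exact: (exchange_seq_le x nm).1.
under eq_fun do rewrite (integral_exchange_seq _).1.
have cint : mu.-integrable setT (EFin \o cst c).
  by apply: finite_measure_integrable_cst.
apply: (dominated_decay _ cint) => [n|n x|].
- exact: (exchange_seq_meas n).2.
- by rewrite (ge0 n x).2 (ile n x).2.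
have aeV : {ae mu, forall x, ~ V x}.
  by exists V; split=> // x /= /contrapT.
apply: filterS2 aeV (ae_regular_point nsa) => x nV rx.
have [g nZ] : exists g, ~ Z (act g x) by apply/existsNP => hx; apply/nV/VE.
have [j nj] : exists j, forall n, j.+1%:R^-1 <= (P n).1 (act g x).
  apply: contrapT => /forallNP hj; apply: nZ => j _.
  by have /existsNP[n /negP] := hj j; rewrite -ltNge => hn; exists n.
have [i ig] := e_surj g^-1%g.
have gi : g = (e i)^-1%g by rewrite ig invgK.
have rgx := regular_act nsa g rx.
have Pi0 : (P i.+1).2 x = 0.
  (* Otherwise the minimum is the translate of the first component, which this step removes
     completely at [act g x], against the lower bound [nj]. *)
  apply/eqP; rewrite subr_eq0 /exchange eq_sym eq_minl leNgt; apply/negP => lt.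
  have hx : h i x = transfer g (P i).1 x by rewrite /exchange (min_r (ltW lt)) gi.
  have := nj i.+1; rewrite leNgt => /negP; apply.
  rewrite /= (_ : _ - _ = 0) ?maxxx ?invr_gt0 //.
  have [xM x0 x1] := rgx.
  have -> : transfer (e i) (h i) (act g x) = h i x * om (e i) (act g x).
    by rewrite /transfer ig (actK nsa).
  rewrite hx /transfer ig -mulrA; apply/eqP; rewrite subr_eq0; apply/eqP.
  have [xM' _ x1'] := rx.
  by rewrite [om g x * _]mulrC -xM' mulVg x1' mulr1.
apply: cvg_near_cst; exists i.+1 => // m /= im; apply/eqP; rewrite eq_le (ge0 m x).2 andbT.
by rewrite -Pi0; exact: (exchange_seq_le x im).2.
Qed.

Context (N : G -> R) (B : nat -> seq G) (C : nat) (Phi : R).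
Hypothesis bb : besicovitch_balls N B C Phi.

Local Notation asum := (ball_sum act om B).
Local Notation weight := (ball_weight om B).

(** The difference telescopes into the coboundaries of the first [n] exchanges, each negligible
    against the weight. *)
Lemma exchange_seq_approx n x (eps : R) : regular x -> small_fringe om N B x -> 0 < eps ->
  exists k0, forall k, (k0 <= k)%N ->
    `|(asum f k x - c * weight k x) - (asum (P n).1 k x - asum (P n).2 k x)|
      <= eps * weight k x.
Proof.
move=> rx sx; have w0 k : 0 <= weight k x by rewrite ltW // (weight_gt0 bb k rx).
elim: n eps => [|n IHn] eps eps0.
  exists 0%N => k _; rewrite /= (_ : asum (cst c) k x = c * weight k x); last first.
    by rewrite /ball_sum /ball_weight mulr_sumr.
  by rewrite subrr normr0 mulr_ge0 // ltW.
have e2 : 0 < eps / 2 by rewrite divr_gt0.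
have [k1 h1] := IHn _ e2.
have [k2 h2] := asum_coboundary_small nsa bb (e n) rx sx (exchange_le n) e2.
exists (maxn k1 k2) => k; rewrite geq_max => /andP[/h1 hk1 /h2 hk2].
have E1 := asum_split nsa B k rx (exchange_seqE n).
have E2 : asum (P n).2 k x = asum (P n.+1).2 k x + asum (h n) k x.
  by apply: (asum_split nsa B k rx) => y _; rewrite /= subrK.
rewrite E1 E2 in hk1; move: hk1 hk2.
move: (asum (P n.+1).1 k x) (asum (P n.+1).2 k x) => a b.
move: (asum (transfer _ _) k x) (asum (h n) k x) (asum f k x - _) => t h' z.
move: (weight k x) => W; rewrite !ler_norml => /andP[? ?] /andP[? ?].
by apply/andP; split; lra.
Qed.

(** A point violating this for [j] lies, for every [n], in one of the exceptional sets of the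
    maximal inequality for the two components; their measures are bounded by multiples of integrals
    tending to 0. *)
Lemma ae_exchange_seq_small : {ae mu, forall x, forall j : nat, exists n, forall k,
  asum (P n).1 k x <= j.+1%:R^-1 * weight k x /\ asum (P n).2 k x <= j.+1%:R^-1 * weight k x}.
Proof.
apply: ae_foralln => j; pose lam : R := j.+1%:R^-1.
have lam0 : 0 < lam by rewrite invr_gt0.
pose U (u : X -> R) := [set x | exists k, lam * weight k x < asum u k x].
have mU u : measurable_fun setT u -> measurable (U u).
  move=> mu_; rewrite (_ : U u = \bigcup_k [set x | lam * weight k x < asum u k x]).
    apply: bigcup_measurable => k _; apply: measurable_lt_set.
      by apply: measurable_funM => //; exact: (ball_weight_measurable nsa).
    exact: (ball_sum_measurable nsa).
  by apply/seteqP; split=> x [k]; [exists k|move=> _ hk; exists k].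
pose Bad := \bigcap_n (U (P n).1 `|` U (P n).2).
have mBad : measurable Bad.
  apply: bigcap_measurable => // n _; have [m1 m2] := exchange_seq_meas n.
  by apply: measurableU; exact: mU.
exists Bad; split=> //; last first.
  move=> x /= /forallNP nx n _; have /existsNP[k hk] := nx n.
  have [h1|h1] := leP (asum (P n).1 k x) (j.+1%:R^-1 * weight k x); last by left; exists k.
  have [h2|h2] := leP (asum (P n).2 k x) (j.+1%:R^-1 * weight k x); last by right; exists k.
  by case: hk.
pose K : R := 2 * (C%:R / lam).
have cv : ((K + K)%:E * \int[mu]_x ((P n).1 x)%:E)%E @[n --> \oo] --> 0%E.
  by rewrite -(mule0 (K + K)%:E); apply: cvgeZl => //; exact: exchange_seq_decay.
apply/eqP; rewrite eq_le measure_ge0 andbT -(cvg_lim _ cv) //.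
apply: lime_ge; first exact: cvgP cv.
apply: nearW => n; have [m1 m2] := exchange_seq_meas n.
have K0 : 0 <= K by rewrite !mulr_ge0 // invr_ge0 ltW.
apply: (@le_trans _ _ (mu (U (P n).1) + mu (U (P n).2))%E).
  apply: le_trans (measureU2 _ _ _); [|exact: mU|exact: mU].
  apply: le_measure; rewrite ?inE //; first by apply: measurableU; exact: mU.
  exact: bigcap_inf.
rewrite EFinD ge0_muleDl ?lee_fin //; apply: leeD.
  apply: (maximal_inequality nsa bb m1) => // x; exact: (exchange_seq_ge0 n x).1.
rewrite (integral_exchange_seq n).1.
by apply: (maximal_inequality nsa bb m2) => // x; exact: (exchange_seq_ge0 n x).2.
Qed.

Lemma ratio_ergodic_nonneg :
  {ae mu, forall x, asum f k x / weight k x @[k --> \oo] --> c}.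
Proof.
have h1 := ae_exchange_seq_small; have h2 := ae_small_fringe nsa bb.
have h3 := ae_regular_point nsa.
near=> x.
have rx : regular x by near: x; exact: h3.
have sx : small_fringe om N B x by near: x; exact: h2.
have hx : forall j : nat, exists n, forall k, asum (P n).1 k x <= j.+1%:R^-1 * weight k x /\
    asum (P n).2 k x <= j.+1%:R^-1 * weight k x by near: x; exact: h1.
have w0 k : 0 < weight k x by exact: (weight_gt0 bb k rx).
apply/cvgrPdist_le => eps eps0.
have e2 : 0 < eps / 2 by rewrite divr_gt0.
have [j jeps] : exists j : nat, j.+1%:R^-1 <= eps / 2.
  exists (Num.bound (eps / 2)^-1); rewrite -[leRHS]invrK lef_pV2 ?posrE ?invr_gt0 //.
  apply: le_trans (ltW (archi_boundP _)) _; first by rewrite invr_ge0 ltW.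
  by rewrite ler_nat.
have [n hn] := hx j; have [k0 hk0] := exchange_seq_approx n rx sx e2.
exists k0 => // k /= /hk0; have [n1 n2] := hn k.
have p1 : 0 <= asum (P n).1 k x.
  by apply: (asum_ge0 nsa) => y; exact: (exchange_seq_ge0 n y).1.
have p2 : 0 <= asum (P n).2 k x.
  by apply: (asum_ge0 nsa) => y; exact: (exchange_seq_ge0 n y).2.
have jw := ler_wpM2r (ltW (w0 k)) jeps.
move: (asum f k x) (asum (P n).1 k x) (asum (P n).2 k x) p1 p2 n1 n2 => z a b p1 p2 n1 n2 hz.
have -> : c - z / weight k x = (c * weight k x - z) / weight k x.
  by field; rewrite gt_eqF.
rewrite normrM normfV (gtr0_norm (w0 k)) ler_pdivrMr //.
move: (weight k x) jw n1 n2 hz => W; move: (j.+1%:R^-1 * W) => V.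
move=> jw n1 n2; rewrite !ler_norml => /andP[? ?].
by apply/andP; split; lra.
Unshelve. all: by end_near. Qed.

End RatioErgodic.

(** * Signed functions and the discrete Heisenberg group *)

Theorem ratio_ergodic (R : realType) (d : measure_display) (X : measurableType d)
    (mu : probability X R) (G : groupType) (act : G -> X -> X) (om : G -> X -> R)
    (N : G -> R) (B : nat -> seq G) (C : nat) (Phi : R) (f : X -> R) :
  nonsingular_action mu act om -> besicovitch_balls N B C Phi ->
  (forall A, measurable A -> (forall g, act g @^-1` A = A) ->
     mu A = 0%E \/ mu (~` A) = 0%E) ->
  mu.-integrable setT (EFin \o f) ->
  {ae mu, forall x, (\sum_(g <- B k) f (act g x) * om g x) / (\sum_(g <- B k) om g x)
     @[k --> \oo] --> Rintegral mu setT f}.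
Proof.
move=> nsa bb ergodic intf; have [e e_surj] := group_countable nsa.
have mf : measurable_fun setT f by apply/measurable_EFinP; exact: measurable_int intf.
pose fp x := Num.max (f x) 0; pose fn x := Num.max (- f x) 0.
have fE x : f x = fp x - fn x.
  rewrite /fp /fn; have /orP[f0|f0] := le_total 0 (f x).
    by rewrite (max_l f0) max_r ?subr0 // oppr_le0.
  by rewrite (max_r f0) max_l ?oppr_ge0 // sub0r opprK.
have mfp : measurable_fun setT fp by apply: measurable_maxr => //; exact: measurable_cst.
have mfn : measurable_fun setT fn.
  by apply: measurable_maxr; [exact: measurable_funN|exact: measurable_cst].
have fp0 x : 0 <= fp x by rewrite le_max lexx orbT.
have fn0 x : 0 <= fn x by rewrite le_max lexx orbT.
have abs_le (u : X -> R) : measurable_fun setT u -> (forall x, 0 <= u x <= `|f x|) ->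
    mu.-integrable setT (EFin \o u).
  move=> mu_ uf; apply: le_integrable intf => //; first exact/measurable_EFinP.
  by move=> x _ /=; have /andP[u0 u1] := uf x; rewrite lee_fin ger0_norm.
have ifp : mu.-integrable setT (EFin \o fp).
  by apply: abs_le => // x; rewrite fp0 /fp ge_max ler_norm normr_ge0.
have ifn : mu.-integrable setT (EFin \o fn).
  by apply: abs_le => // x; rewrite fn0 /fn ge_max -normrN ler_norm normr_ge0.
have main (u : X -> R) : measurable_fun setT u -> (forall x, 0 <= u x) ->
    mu.-integrable setT (EFin \o u) ->
    {ae mu, forall x, ball_sum act om B u k x / ball_weight om B k x @[k --> \oo] -->
      Rintegral mu setT u}.
  move=> mu_ u0 iu; apply: (ratio_ergodic_nonneg nsa ergodic e_surj mu_ u0 _ _ bb).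
    by apply: fine_ge0; apply: integral_ge0 => x _; rewrite lee_fin.
  by rewrite /Rintegral fineK //; exact: integrable_fin_num.
have -> : Rintegral mu setT f = Rintegral mu setT fp - Rintegral mu setT fn.
  by rewrite -RintegralB //; apply: eq_Rintegral => x _; exact: fE.
apply: filterS2 (main fp mfp fp0 ifp) (main fn mfn fn0 ifn) => x hp hn.
rewrite (_ : (fun k => _) = (fun k => ball_sum act om B fp k x / ball_weight om B k x -
  ball_sum act om B fn k x / ball_weight om B k x)); first exact: cvgB hp hn.
apply/funext => k; rewrite -mulrBl; congr (_ / _); rewrite /ball_sum -sumrB; apply: eq_bigr => g _.
by rewrite (fE (act g x)) mulrBl.
Qed.

Theorem theorem1 (R : realType) (n : nat) (d : measure_display)
    (X : measurableType d) (mu : probability X R)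
    (act : heis R n -> X -> X) (omega : heis R n -> X -> R) :
  standard_borel X R ->
  (* non-singular action of H^n by measurable bijections *)
  (forall g, inHd g -> measurable_fun setT (act g)) ->
  (forall g, inHd g -> bijective (act g)) ->
  (forall x, act (@hone R n) x = x) ->
  (forall g h, inHd g -> inHd h -> forall x, act (hmul g h) x = act g (act h x)) ->
  (forall g, inHd g -> forall A, measurable A ->
     (mu (act g @` A) = 0%E <-> mu A = 0%E)) ->
  (* omega g = d(mu o g)/d mu *)
  (forall g, inHd g ->
     [/\ measurable_fun setT (omega g), (forall x, 0 <= omega g x) &
        forall A, measurable A ->
          mu (act g @` A) = (\int[mu]_(x in A) (omega g x)%:E)%E]) ->
  (* ergodicity *)
  (forall A, measurable A -> (forall g, inHd g -> act g @^-1` A = A) ->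
     mu A = 0%E \/ mu (~` A) = 0%E) ->
  forall f : X -> R, mu.-integrable setT (EFin \o f) ->
  {ae mu, forall x,
     ((fun k : nat =>
        (\sum_(g \in @Hball R n k) f (act g x) * omega g x) /
        (\sum_(g \in @Hball R n k) omega g x)) : nat -> R) @ \oo
     --> Rintegral mu setT f}.
Proof.
move=> _ act_meas _ act1 actM act_ns om_rn ergodic f intf.
have [C [Phi col]] := gdist_colorable R n.
have inH := @hemb_inHd R n.
have bb : besicovitch_balls (@dnorm R n) (@dball R n) C Phi.
  split=> //; [exact: dnorm1|exact: dnormV|exact: dnormM|exact: dball_uniq|exact: mem_dball|
    exact: dball_growth].
(* Composition with [hemb] turns the action, controlled only on the lattice points of [heis R n],
   into an action of the countable group [dheis n]. *)
have nsa : nonsingular_action mu (fun g => act (hemb R g)) (fun g => omega (hemb R g)).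
  split=> [||x|g h x|g A mA|g|g|g A mA].
  - exists (fun i => odflt 1%g (unpickle i : option (dheis n))) => g.
    by exists (pickle g); rewrite pickleK.
  - by move=> g; apply: act_meas.
  - by rewrite hemb1.
  - by rewrite hembM actM.
  - by case: (act_ns _ (inH g) A mA).
  - by case: (om_rn _ (inH g)).
  - by case: (om_rn _ (inH g)).
  - by case: (om_rn _ (inH g)) => _ _; apply.
have erg A : measurable A -> (forall g, act (hemb R g) @^-1` A = A) ->
    mu A = 0%E \/ mu (~` A) = 0%E.
  by move=> mA invA; apply: ergodic => // p /hemb_surj[g <-].
apply: filterS (ratio_ergodic nsa bb erg intf) => x.
rewrite [X in X @ _ --> _ -> _](_ : _ = fun k : nat =>
  (\sum_(g \in @Hball R n k) f (act g x) * omega g x) /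
  (\sum_(g \in @Hball R n k) omega g x)) //.
by apply/funext => k; rewrite !sum_Hball.
Qed.
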